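(* Let $p$ be an odd prime, let $G$ be a noncyclic group of nilpotency class at most two and exponent $p$, and let $g_1,\ldots,g_n$ be elements of $G$ that project onto a basis for $G^{\rm ab}$. Let $F$ be the $3$-nilpotent product of $n$ cyclic groups of order $p$ generated by $x_1,\ldots,x_n$, respectively, let $\psi\colon F\to G$ be the morphism induced by $x_i\mapsto g_i$, let $N=\ker(\psi)$, and let $C=\langle [x_j,x_i]\mid 1\leq i<j\leq n\rangle\leq F$. Write $N=X\oplus F_3$ with $X$ a subgroup of $C$, and regard $X$ as a subspace of $V=U\wedge U$ by identifying $C$ with $V$ via $[x_j,x_i]\leftrightarrow v_{ji}=u_j\wedge u_i$ ($1\le i<j\le n$). Then $G$ is capable if and only if $X$ is $\{\varphi_{\mathbf{u}}\mid \mathbf{u}\in U\}$-closed, i.e. $X=X^{**}$.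
   Context: A group $G$ is capable if there exists a group $H$ such that $G\cong H/Z(H)$. The lower central series of a group $K$ is $K_1=K$, $K_{m+1}=[K_m,K]$. The $3$-nilpotent product of cyclic groups $A_1,\ldots,A_n$ is $P/P_4$, where $P=A_1*\cdots*A_n$ is the free product. Commutators are $[x,y]=x^{-1}y^{-1}xy$. $G^{\rm ab}=G/[G,G]$ is viewed as an $\mathbb{F}_p$-vector space. In $F$, the subgroup $F_2$ is elementary abelian, $C$ is elementary abelian with basis the commutators $[x_j,x_i]$, $1\le i<j\le n$, and $F_2=C\oplus F_3$; since $G$ has class at most two and exponent $p$, $F_3\subseteq N\subseteq F_2$, and $X=N\cap C$. Let $U$ be an $\mathbb{F}_p$-vector space with basis $u_1,\ldots,u_n$, let $V=U\wedge U$, and let $W=(V\otimes U)/J$, where $J$ is the subspace spanned by all $(\mathbf{a}\wedge\mathbf{b})\otimes\mathbf{c}+(\mathbf{b}\wedge\mathbf{c})\otimes\mathbf{a}+(\mathbf{c}\wedge\mathbf{a})\otimes\mathbf{b}$ with $\mathbf{a},\mathbf{b},\mathbf{c}\in U$. For $\mathbf{u}\in U$, $\varphi_{\mathbf{u}}\colon V\to W$ is the linear map sending $\mathbf{v}$ to the image of $\mathbf{v}\otimes\mathbf{u}$ in $W$. For a subspace $X\leq V$, $X^*={\rm span}(\varphi_{\mathbf{u}}(X)\mid \mathbf{u}\in U)\leq W$; for a subspace $Y\leq W$, $Y^*=\bigcap_{\mathbf{u}\in U}\varphi_{\mathbf{u}}^{-1}(Y)\leq V$; and $X^{**}=(X^*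 )^*$. *)

(* Defs.v *)
From HB Require Import structures.
From mathcomp Require Import all_boot all_order all_algebra.
From mathcomp Require Import boolp classical_sets.
Set Implicit Arguments.
Unset Strict Implicit.
Unset Printing Implicit Defensive.
Import GRing.Theory.
Local Open Scope classical_set_scope.
Local Open Scope quotient_scope.
Local Open Scope group_scope.

(** * Groups *)

(* The groups below are MathComp's [groupType]s, which need not be finite:
   the witness for capability may be infinite, and so may a free product. *)

Definition subgroup (G : groupType) (A : set G) : Prop :=
  A 1 /\ (forall x y, A x -> A y -> A (x / y)).

Definition gen (G : groupType) (S : set G) : set G := smallest (@subgroup G) S.

Definition comm_sub (G : groupType) (A B : set G) : set G :=
  gen [set z | exists a b, [/\ A a, B b & z = [~ a, b]]].

(* [lcs G m] is K_m for K = G; the index 0 is unused. *)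
Fixpoint lcs (G : groupType) (m : nat) : set G :=
  if m is m'.+1 then
    if m' is 0 then setT else comm_sub (@lcs G m') setT
  else setT.
Arguments lcs : clear implicits.

Definition center (G : groupType) : set G := [set z | forall x, commute z x].
Arguments center : clear implicits.

Definition class_le (G : groupType) (c : nat) : Prop := lcs G c.+1 = [set 1].

Definition is_exponent (G : groupType) (m : nat) : Prop :=
  [/\ (0 < m)%N, forall x : G, x ^+ m = 1
    & forall k, (0 < k)%N -> (forall x : G, x ^+ k = 1) -> (m <= k)%N].

Definition is_cyclic (G : groupType) : Prop :=
  exists x : G, forall y : G, exists k : nat, y = x ^+ k \/ y = x ^- k.

Definition kernel (G H : groupType) (f : {multiplicative G -> H}) : set G :=
  [set x | f x = 1].

Definition isomorphic (G H : groupType) : Prop :=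
  exists f : {multiplicative G -> H}, bijective f.

Definition direct_sum (G : groupType) (A B N : set G) : Prop :=
  [/\ subgroup A /\ subgroup B,
      forall a b, A a -> B b -> commute a b,
      A `&` B = [set 1]
    & N = [set z | exists a b, [/\ A a, B b & z = a * b]]].

Section QuotientGroup.

Definition is_normal (G : groupType) (N : set G) : Prop :=
  subgroup N /\ (forall x y, N x -> N (x ^ y)).

Record normal_sub (G : groupType) := NormalSub {
  normal_set :> set G;
  normal_setP : is_normal normal_set }.

Variables (G : groupType) (N : normal_sub G).

Let N1 : (N : set G) 1. Proof. by have [[]] := normal_setP N. Qed.
Let NJ x y : (N : set G) x -> (N : set G) (x ^ y).
Proof. by have [_] := normal_setP N; apply. Qed.
Let NV x : (N : set G) x -> (N : set G) x^-1.
Proof.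
by have [[n1 nd] _] := normal_setP N => nx; rewrite -[x^-1]mul1g; apply: nd.
Qed.
Let NM x y : (N : set G) x -> (N : set G) y -> (N : set G) (x * y).
Proof.
have [[n1 nd] _] := normal_setP N => nx ny.
by rewrite -[y]invgK; apply: nd => //; apply: NV.
Qed.

Definition coset_rel : rel G := fun x y => `[< (N : set G) (x^-1 * y) >].

Let coset_refl : reflexive coset_rel.
Proof. by move=> x; apply/asboolP; rewrite mulVg. Qed.

Let coset_imp x y : coset_rel x y -> coset_rel y x.
Proof. by move=> /asboolP /NV; rewrite invgM invgK => h; apply/asboolP. Qed.

Let coset_sym : symmetric coset_rel.
Proof. by move=> x y; apply/idP/idP; apply: coset_imp. Qed.

Let coset_trans : transitive coset_rel.
Proof.
move=> y x z /asboolP xy /asboolP yz; apply/asboolP.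
by have := NM xy yz; rewrite mulgA mulgK.
Qed.

Canonical coset_equiv := EquivRel coset_rel coset_refl coset_sym coset_trans.

Definition quotg := {eq_quot coset_equiv}.
HB.instance Definition _ := Choice.on quotg.
HB.instance Definition _ := EqQuotient.on quotg.

Definition coset (x : G) : quotg := \pi_quotg x.

Lemma cosetE x y : coset x = coset y <-> (N : set G) (x^-1 * y).
Proof. by split=> [/eqmodP/asboolP|h]; last by apply/eqmodP/asboolP. Qed.

Definition qone : quotg := coset 1.
Definition qinv (a : quotg) : quotg := coset (repr a)^-1.
Definition qmul (a b : quotg) : quotg := coset (repr a * repr b).

Let coset_repr a : coset (repr a) = a. Proof. exact: reprK. Qed.

Let qmulE x y : qmul (coset x) (coset y) = coset (x * y).
Proof.
have /cosetE hx := coset_repr (coset x).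
have /cosetE hy := coset_repr (coset y).
apply/cosetE; rewrite invgM -!mulgA [_^-1 * (x * y)]mulgA.
set u := repr _ in hx *; set v := repr _ in hy *.
have -> : v^-1 * (u^-1 * x * y) = (u^-1 * x) ^ v * (v^-1 * y).
  by rewrite conjgE -!mulgA mulVKg.
by apply: NM => //; apply: NJ.
Qed.

Let qinvE x : qinv (coset x) = coset x^-1.
Proof.
have /cosetE hx := coset_repr (coset x); apply/cosetE; rewrite invgK.
set u := repr _ in hx *.
have -> : u * x^-1 = ((u^-1 * x)^-1) ^ u^-1.
  by rewrite conjgE invgM !invgK -!mulgA mulgV mulg1.
by apply: NJ; apply: NV.
Qed.

Let quot_ind (P : quotg -> Prop) : (forall x, P (coset x)) -> forall a, P a.
Proof. by move=> h a; rewrite -[a]coset_repr. Qed.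

Let qmulA : associative qmul.
Proof.
elim/quot_ind=> x; elim/quot_ind=> y; elim/quot_ind=> z.
by rewrite !qmulE mulgA.
Qed.
Let qmul1 : left_id qone qmul.
Proof. by elim/quot_ind=> x; rewrite qmulE mul1g. Qed.
Let qmulr1 : right_id qone qmul.
Proof. by elim/quot_ind=> x; rewrite qmulE mulg1. Qed.
Let qmulV : left_inverse qone qinv qmul.
Proof. by elim/quot_ind=> x; rewrite qinvE qmulE mulVg. Qed.
Let qmulrV : right_inverse qone qinv qmul.
Proof. by elim/quot_ind=> x; rewrite qinvE qmulE mulgV. Qed.

HB.instance Definition _ :=
  isGroup.Build quotg qmulA qmul1 qmulr1 qmulV qmulrV.

Let coset_morph : {morph coset : x y / x * y}.
Proof. by move=> x y; rewrite -qmulE. Qed.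
HB.instance Definition _ := isMultiplicative.Build G quotg coset coset_morph.

End QuotientGroup.

Lemma lcs_normal (G : groupType) (m : nat) : is_normal (lcs G m).
Proof.
have nT : is_normal (setT : set G) by [].
case: m => [//|m]; elim: m => [//|m IH].
have sgen (S : set G) : subgroup (gen S).
  split=> [A [[] //]|x y hx hy A hA].
  by case: (hA) => -[_ hd] _; exact: hd (hx A hA) (hy A hA).
split=> [|x y hx]; first exact: sgen.
suff: [set z | lcs G m.+2 (z ^ y)] x by [].
apply: (hx [set z | lcs G m.+2 (z ^ y)]) => {x hx}; split.
  split=> [|a b /= ha hb]; first by rewrite /= conj1g; exact: (sgen _).1.
  by rewrite conjMg conjVg; exact: (sgen _).2.
move=> _ [a [b [ha _ ->]]] A [_ hA]; apply: hA.
exists (a ^ y), (b ^ y); split=> //; last by rewrite conjRg.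
by case: IH => _; apply.
Qed.

Lemma center_normal (G : groupType) : is_normal (center G).
Proof.
split=> [|x y hx].
  split=> [z|x y hx hy z]; first exact/commute_sym/commute1.
  apply/commute_sym/commuteM; first exact/commute_sym/hx.
  exact/commuteV/commute_sym/hy.
by have -> : x ^ y = x by rewrite conjgE hx mulKg.
Qed.

Definition lcsN (G : groupType) (m : nat) : normal_sub G :=
  NormalSub (lcs_normal G m).
Definition centerN (G : groupType) : normal_sub G :=
  NormalSub (center_normal G).

Definition capable (G : groupType) : Prop :=
  exists H : groupType, isomorphic G (quotg (centerN H)).

Definition abelianization (G : groupType) := quotg (lcsN G 2).

(* [a] is the tuple of coordinates of an element of G^ab in the images of the
   g_i, the F_p-vector space G^ab being written multiplicatively. *)
Definition ab_basis (p n : nat) (G : groupType) (g : 'I_n -> G) : Prop :=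
  forall y : abelianization G, exists! a : {ffun 'I_n -> 'F_p},
    y = \prod_(i < n) (coset (lcsN G 2) (g i)) ^+ (a i : nat).

Section FreeProduct.

Variables (I : choiceType) (A : I -> groupType).

Definition letter := {i : I & A i}.
Definition mkletter (i : I) (a : A i) : letter := Tagged (fun j => A j) a.
Definition word := seq letter.

Inductive fp_cong : word -> word -> Prop :=
| fp_refl w : fp_cong w w
| fp_sym w w' : fp_cong w w' -> fp_cong w' w
| fp_trans w w' w'' : fp_cong w w' -> fp_cong w' w'' -> fp_cong w w''
| fp_cat u u' w w' :
    fp_cong u u' -> fp_cong w w' -> fp_cong (u ++ w) (u' ++ w')
| fp_one i : fp_cong [:: mkletter (1 : A i)] [::]
| fp_mul i (a b : A i) :
    fp_cong [:: mkletter a; mkletter b] [:: mkletter (a * b)].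

Definition fp_rel : rel word := fun u w => `[< fp_cong u w >].

Let fp_rel_refl : reflexive fp_rel.
Proof. by move=> w; apply/asboolP/fp_refl. Qed.
Let fp_rel_sym : symmetric fp_rel.
Proof.
by move=> u w; apply/idP/idP => /asboolP h; apply/asboolP; apply: fp_sym.
Qed.
Let fp_rel_trans : transitive fp_rel.
Proof.
move=> v u w /asboolP uv /asboolP vw; apply/asboolP; exact: fp_trans uv vw.
Qed.

Canonical fp_equiv := EquivRel fp_rel fp_rel_refl fp_rel_sym fp_rel_trans.

Definition free_product := {eq_quot fp_equiv}.
HB.instance Definition _ := Choice.on free_product.
HB.instance Definition _ := EqQuotient.on free_product.

Definition fp_class (w : word) : free_product := \pi_free_product w.

Lemma fp_classE u w : fp_class u = fp_class w <-> fp_cong u w.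
Proof. by split=> [/eqmodP/asboolP|h]; last by apply/eqmodP/asboolP. Qed.

Definition linv (l : letter) : letter := mkletter (projT2 l)^-1.
Definition winv (w : word) : word := rev (map linv w).

Let winv_cat u w : winv (u ++ w) = winv w ++ winv u.
Proof. by rewrite /winv map_cat rev_cat. Qed.

Let winv_cong u w : fp_cong u w -> fp_cong (winv u) (winv w).
Proof.
elim=> {u w}
  [w|w w' _|w w' w'' _ h _|u u' w w' _ hu _ hw|i|i a b].
- exact: fp_refl.
- exact: fp_sym.
- exact: fp_trans.
- by rewrite !winv_cat; apply: fp_cat.
- by rewrite /winv /= /linv /= invg1; apply: fp_one.
by rewrite /winv /= /linv /= invgM; apply: fp_mul.
Qed.

Let winvK : involutive winv.
Proof.
move=> w; rewrite /winv map_rev revK -map_comp map_id_in // => -[i a] _.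
by rewrite /= /linv /= invgK.
Qed.

Let mulVw w : fp_cong (winv w ++ w) [::].
Proof.
elim: w => [|[i a] w IH]; first exact: fp_refl.
rewrite -cat1s winv_cat -catA; apply: fp_trans IH.
apply: fp_cat; first exact: fp_refl.
rewrite catA -[w in X in fp_cong _ X]cat0s.
apply: fp_cat; last exact: fp_refl.
by apply: fp_trans (fp_one i); rewrite -(mulVg a); apply: fp_mul.
Qed.

Definition fp_unit : free_product := fp_class [::].
Definition fp_inv (a : free_product) := fp_class (winv (repr a)).
Definition fp_prod (a b : free_product) := fp_class (repr a ++ repr b).

Let repr_cong w : fp_cong (repr (fp_class w)) w.
Proof. by apply/fp_classE; apply: reprK. Qed.

Let fp_prodE u w : fp_prod (fp_class u) (fp_class w) = fp_class (u ++ w).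
Proof. by apply/fp_classE; apply: fp_cat; apply: repr_cong. Qed.

Let fp_invE w : fp_inv (fp_class w) = fp_class (winv w).
Proof. by apply/fp_classE/winv_cong/repr_cong. Qed.

Let fp_ind (P : free_product -> Prop) :
  (forall w, P (fp_class w)) -> forall a, P a.
Proof. by move=> h a; rewrite -[a]reprK; apply: h. Qed.

Let fp_mulA : associative fp_prod.
Proof.
elim/fp_ind=> x; elim/fp_ind=> y; elim/fp_ind=> z.
by rewrite !fp_prodE catA.
Qed.
Let fp_mul1 : left_id fp_unit fp_prod.
Proof. by elim/fp_ind=> x; rewrite fp_prodE. Qed.
Let fp_mulr1 : right_id fp_unit fp_prod.
Proof. by elim/fp_ind=> x; rewrite fp_prodE cats0. Qed.
Let fp_mulV : left_inverse fp_unit fp_inv fp_prod.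
Proof. by elim/fp_ind=> x; rewrite fp_invE fp_prodE; apply/fp_classE. Qed.
Let fp_mulrV : right_inverse fp_unit fp_inv fp_prod.
Proof.
elim/fp_ind=> x; rewrite fp_invE fp_prodE; apply/fp_classE.
by rewrite -{1}[x]winvK.
Qed.

HB.instance Definition _ :=
  isGroup.Build free_product fp_mulA fp_mul1 fp_mulr1 fp_mulV fp_mulrV.

Definition fp_in (i : I) (a : A i) : free_product := fp_class [:: mkletter a].

End FreeProduct.

Definition nilpotent_product (c : nat) (I : choiceType) (A : I -> groupType) :=
  quotg (lcsN (free_product A) c.+1).

(* MathComp's multiplicative [groupType] structure on 'Z_p is its additive
   group, generated by 1%R; it has order p since p > 1. *)
Definition cyclic_family (p n : nat) (i : 'I_n) : groupType := 'Z_p.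
Definition F3 (p n : nat) : groupType :=
  nilpotent_product 3 (@cyclic_family p n).
Definition F3_gen (p n : nat) (i : 'I_n) : F3 p n :=
  coset (lcsN (free_product (@cyclic_family p n)) 4)
    (fp_in (1%R : cyclic_family p i)).

Definition F3_C (p n : nat) : set (F3 p n) :=
  gen [set z | exists i j : 'I_n,
         (i < j)%N /\ z = [~ F3_gen p j, F3_gen p i]].

(** * Linear algebra *)

Local Open Scope ring_scope.

Section QuotientSpace.

Variables (K : fieldType) (E : vectType K) (J : {vspace E}).

(* E / J is realised as the complement J^C of J, with the projection along J
   as canonical map. *)
Definition quotv : vectType K := subvs_of (J^C)%VS.
Definition piv : 'Hom(E, quotv) :=
  (linfun (vsproj (J^C)%VS) \o daddv_pi (J^C)%VS J)%VF.

Let pivE x : vsval (piv x) = daddv_pi (J^C)%VS J x.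
Proof. by rewrite comp_lfunE lfunE /= vsprojK ?memv_pi. Qed.

Let CJ : (J^C :&: J = 0)%VS. Proof. by rewrite capvC capv_compl. Qed.

Lemma lker_piv : lker piv = J.
Proof.
apply/vspaceP => x; rewrite memv_ker -(inj_eq subvs_inj) pivE linear0.
have hx : x \in (J^C + J)%VS by rewrite addvC addv_complf memvf.
have := daddv_pi_add CJ hx; set u := daddv_pi _ _ _ => hs.
apply/eqP/idP => [u0|xJ]; first by rewrite -hs u0 add0r memv_pi.
have: u \in (J^C :&: J)%VS.
  rewrite memv_cap memv_pi /= -(_ : x - daddv_pi J J^C x = u) ?memvB ?memv_pi //.
  by rewrite -{1}hs addrK.
by rewrite CJ memv0 => /eqP.
Qed.

Lemma limg_piv : limg piv = fullv.
Proof.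
apply/vspaceP => y; rewrite memvf; apply/memv_imgP; exists (vsval y).
  exact: memvf.
by apply: subvs_inj; rewrite pivE daddv_pi_id // subvsP.
Qed.

End QuotientSpace.

Section Tensor.

Variables (K : fieldType) (A B : vectType K).

(* In coordinates, a (x) b is the matrix (a_i b_j)_(i, j). *)
Definition tensor : vectType K := 'M[K]_(\dim {:A}, \dim {:B}).
Definition tens (a : A) (b : B) : tensor :=
  \matrix_(i, j) (coord (vbasis {:A}) i a * coord (vbasis {:B}) j b).

Lemma tens_linearl (b : B) : linear (tens^~ b).
Proof.
by move=> k x y; apply/matrixP => i j; rewrite !mxE linearP /= mulrDl mulrA.
Qed.

Lemma tens_linearr (a : A) : linear (tens a).
Proof.
by move=> k x y; apply/matrixP => i j; rewrite !mxE linearP /= mulrDr mulrCA.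
Qed.

End Tensor.

Section Spaces.

Variables (p n : nat).

Definition U : vectType 'F_p := 'rV['F_p]_n.
Definition ub (i : 'I_n) : U := delta_mx 0 i.

(* Sums and intersections over all vectors of U make sense because the set
   'rV['F_p]_n is finite. *)
Definition V : vectType 'F_p :=
  quotv (\sum_(a : 'rV['F_p]_n) <[tens (a : U) (a : U)]>)%VS.
Definition wedge (a b : U) : V := piv _ (tens a b).

Definition J : {vspace tensor V U} :=
  (\sum_(a : 'rV['F_p]_n) \sum_(b : 'rV['F_p]_n) \sum_(c : 'rV['F_p]_n)
     <[tens (wedge a b) (c : U) + tens (wedge b c) (a : U)
       + tens (wedge c a) (b : U)]>)%VS.
Definition W : vectType 'F_p := quotv J.

Definition phi_fun (u : U) (v : V) : W := piv J (tens v u).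
Definition phi (u : U) : 'Hom(V, W) := linfun (phi_fun u).

Lemma phi_linear (u : U) : linear (phi_fun u).
Proof. by move=> k x y; rewrite /phi_fun tens_linearl linearP. Qed.
HB.instance Definition _ (u : U) :=
  GRing.isLinear.Build 'F_p V W _ (phi_fun u) (phi_linear u).
Lemma phiE (u : U) (v : V) : phi u v = piv J (tens v u).
Proof. by rewrite lfunE. Qed.

Definition upstar (X : {vspace V}) : {vspace W} :=
  (\sum_(u : 'rV['F_p]_n) (phi u @: X))%VS.
Definition downstar (Y : {vspace W}) : {vspace V} :=
  (\bigcap_(u : 'rV['F_p]_n) (phi u @^-1: Y))%VS.

Definition phi_closed (X : {vspace V}) : Prop := X = downstar (upstar X).

(* The entries a i j with i < j are the coordinates, on the [x_j, x_i] and on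
   the v_ji = u_j /\ u_i respectively, of an element of C and of the element
   of V identified with it. *)
Definition C_elt (a : 'M['F_p]_n) : F3 p n :=
  (\prod_(i < n) \prod_(j < n | (i < j)%N)
     [~ F3_gen p j, F3_gen p i] ^+ (a i j : nat))%g.
Definition V_elt (a : 'M['F_p]_n) : V :=
  \sum_(i < n) \sum_(j < n | (i < j)%N) a i j *: wedge (ub j) (ub i).

(* When X is a subgroup of C the vectors V_elt a listed here already form a
   subspace, which is the one identified with X. *)
Definition subspace_of (X : set (F3 p n)) : {vspace V} :=
  (\sum_(a : 'M['F_p]_n | `[< X (C_elt a) >]) <[V_elt a]>)%VS.

End Spaces.

(* Main.v *)
(* Write [a, b, c] for phi_c (a /\ b).

   Suppose G = H / Z(H), and let h_i in H lift g_i.  Then H has class at most 3,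
   and the triple commutators of the h_i have order p, commute, and satisfy the
   relations defining W; so there is a linear map D on W such that, for
   v = sum a_ij u_j /\ u_i and h_v = prod [h_j, h_i]^a_ij, the elements h_v and
   h_k commute iff D (phi_k v) = 0.  Now h_v is central iff v maps to 1 in G.
   Hence D vanishes on X*, so that v in X** makes h_v central and v in X.

   Conversely, map x_i to 1 + u_i in the tensor algebra of U truncated above
   degree 3, its degree 3 part being pushed to W / X* by a left inverse of the
   embedding of W as the Lie elements of degree 3.  An element of F whose image
   commutes with all the generators has no linear part because n >= 2, so it is
   v f with v in C and f in F_3, and then phi_u v is in X* for every u; that is,
   v is in X** = X.  So the quotient of F by the kernel of this map has central
   quotient F / N = G. *)

From HB Require Import structures.
Require Import Defs.
From mathcomp Require Import all_boot all_order all_algebra.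
From mathcomp Require Import boolp classical_sets.
From mathcomp Require Import ring.
Set Implicit Arguments.
Unset Strict Implicit.
Unset Printing Implicit Defensive.
Import GRing.Theory.
Local Open Scope group_scope.

(** * Commutator calculus in class three *)

Section Commutators.

Variable G : groupType.
Implicit Types x y z w c d : G.

Lemma commMgJ_group x y z : [~ x * y, z] = [~ x, z] ^ y * [~ y, z].
Proof. by rewrite !commgEl conjMg !conjgE invgM !gnorm. Qed.

Lemma commgMJ_group x y z : [~ x, y * z] = [~ x, z] * [~ x, y] ^ z.
Proof. by rewrite !commgEl !conjgE !gnorm. Qed.

Lemma conjg_commute x y : commute x y -> x ^ y = x.
Proof. by move=> h; rewrite conjgE h mulKg. Qed.

Lemma commute1P x y : commute x y <-> [~ x, y] = 1.
Proof. by split=> [/commgP/eqP|/eqP/commgP]. Qed.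

Lemma commg_prod_central (I : Type) (r : seq I) (P : pred I) (F : I -> G) z :
    (forall i w, commute [~ F i, z] w) ->
  [~ \prod_(i <- r | P i) F i, z] = \prod_(i <- r | P i) [~ F i, z].
Proof.
move=> h; elim: r => [|i r IH]; first by rewrite !big_nil comm1g.
rewrite !big_cons; case: (P i) => //.
by rewrite commMgJ_group (conjg_commute (h _ _)) IH.
Qed.

Lemma commgX_central x z k :
  (forall w, commute [~ x, z] w) -> [~ x ^+ k, z] = [~ x, z] ^+ k.
Proof.
move=> h; elim: k => [|k IH]; first by rewrite comm1g.
by rewrite !expgS commMgJ_group (conjg_commute (h _)) IH.
Qed.

Lemma Hall_Witt x y z :
  [~ x, y^-1, z] ^ y * [~ y, z^-1, x] ^ z * [~ z, x^-1, y] ^ x = 1.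
Proof.
(* Each conjugated factor is a quotient of two cyclically consecutive values of [a], so the product
   telescopes. *)
pose a x y z : G := x * z * y ^ x.
suffices hw_aux x' y' z' :
    [~ x', y'^-1, z'] ^ y' = (a x' y' z')^-1 * a y' z' x'.
  by rewrite !hw_aux; move: a {hw_aux} => a; rewrite 2!mulgA !mulgK mulVg.
by rewrite /a !commgEl !conjgE !gnorm.
Qed.

Lemma mem_gen (S : set G) x : S x -> gen S x.
Proof. by move=> hx A [_]; apply. Qed.

Lemma gen_sub (S A : set G) :
  subgroup A -> (S `<=` A)%classic -> (gen S `<=` A)%classic.
Proof. by move=> hA hS x; apply. Qed.

Lemma subgroupV (A : set G) x : subgroup A -> A x -> A x^-1.
Proof. by case=> h1 hd hx; rewrite -[x^-1]mul1g; apply: hd. Qed.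

Lemma subgroupM (A : set G) x y : subgroup A -> A x -> A y -> A (x * y).
Proof.
by move=> hA hx hy; rewrite -[y]invgK; apply: hA.2 => //; apply: subgroupV.
Qed.

Lemma subgroupX (A : set G) x k : subgroup A -> A x -> A (x ^+ k).
Proof.
move=> hA hx; elim: k => [|k IH]; first exact: hA.1.
by rewrite expgS; apply: subgroupM.
Qed.

Lemma subgroup_prod (A : set G) (I : Type) (r : seq I) (P : pred I)
    (F : I -> G) :
  subgroup A -> (forall i, P i -> A (F i)) -> A (\prod_(i <- r | P i) F i).
Proof.
by move=> hA h; apply: big_ind => // [|x y]; [apply: hA.1|apply: subgroupM].
Qed.

Lemma lcsS m x y : lcs G m.+1 x -> lcs G m.+2 [~ x, y].
Proof. by move=> hx; apply: mem_gen; exists x, y. Qed.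

Lemma lcs1 x : lcs G 1 x.
Proof. by []. Qed.

Lemma lcs_subgroup m : subgroup (lcs G m).
Proof. by case: (lcs_normal G m). Qed.

End Commutators.

Section Multiplicative.

(* MathComp states the group-morphism lemmas for bundled unital morphisms only. *)
Variables (G H : groupType) (f : {multiplicative G -> H}).

Lemma mult1 : f 1 = 1.
Proof. by apply: (mulgI (f 1)); rewrite -gmulfM !mulg1. Qed.

Definition unital : UMagmaMorphism.type G H :=
  HB.pack (Multiplicative.sort f)
    (Multiplicative_isUMagmaMorphism.Build G H f mult1).

Lemma multV x : f x^-1 = (f x)^-1.
Proof. exact: (gmulfV unital). Qed.

Lemma multR x y : f [~ x, y] = [~ f x, f y].
Proof. exact: (gmulfR unital). Qed.

Lemma multX x k : f (x ^+ k) = f x ^+ k.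
Proof. exact: (gmulfXn unital). Qed.

Lemma mult_prod (I : Type) (r : seq I) (P : pred I) (E : I -> G) :
  f (\prod_(i <- r | P i) E i) = \prod_(i <- r | P i) f (E i).
Proof. exact: (gmulf_prod unital). Qed.

End Multiplicative.

Lemma lcs_morph (G H : groupType) (f : {multiplicative G -> H}) m x :
  lcs G m x -> lcs H m (f x).
Proof.
case: m => // m; elim: m x => // m IH x.
apply: (gen_sub (A := [set y | lcs H m.+2 (f y)]%classic)).
  have hs := lcs_subgroup H m.+2; split=> [|y z hy hz] /=.
    by rewrite mult1; apply: hs.1.
  by rewrite gmulfM multV; apply: hs.2.
by move=> _ [a [b [ha _ ->]]] /=; rewrite multR; apply: lcsS; apply: IH.
Qed.

(** * Multilinearity of central triple commutators *)

Section ClassThree.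

Variable G : groupType.
Hypothesis class3 : forall x y z w : G, commute [~ x, y, z] w.
Implicit Types x y z w : G.

Let J3 x y z w : [~ x, y, z] ^ w = [~ x, y, z].
Proof. exact: conjg_commute. Qed.

Let comm4 x y z w : [~ x, y, z, w] = 1.
Proof. by apply/commute1P. Qed.

Lemma comm3Mr x y z w : [~ x, y, z * w] = [~ x, y, z] * [~ x, y, w].
Proof. by rewrite commgMJ_group J3; apply: (commute_sym (class3 _ _ _ _)). Qed.

(** The correction factor [[~ x, z, y]] in the expansion of [[~ x * y, z]] is central, so a further
    commutator kills it. *)
Lemma comm3Ml x y z w : [~ x * y, z, w] = [~ x, z, w] * [~ y, z, w].
Proof.
have -> : [~ x * y, z] = [~ x, z] * [~ x, z, y] * [~ y, z].
  by rewrite commMgJ_group [in RHS]commgEl mulVKg.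
by rewrite (commMgJ_group ([~ x, z] * [~ x, z, y])) (commMgJ_group [~ x, z])
  comm4 mulg1 !J3.
Qed.

Lemma comm3Vr x y z : [~ x, y, z^-1] = [~ x, y, z]^-1.
Proof. by apply: (mulgI [~ x, y, z]); rewrite -comm3Mr !mulgV commg1. Qed.

Lemma comm3Xr x y z k : [~ x, y, z ^+ k] = [~ x, y, z] ^+ k.
Proof. by elim: k => [|k IH]; rewrite ?commg1 // !expgS comm3Mr IH. Qed.

Lemma comm3_inv x y z : [~ y, x, z] = [~ x, y, z]^-1.
Proof.
rewrite -(invgR x y); apply: (mulgI [~ x, y, z]); rewrite mulgV.
by rewrite -[X in X * _](J3 x y z [~ x, y]^-1) -commMgJ_group mulgV comm1g.
Qed.

Lemma comm3Mm x y z w : [~ x, y * z, w] = [~ x, y, w] * [~ x, z, w].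
Proof.
rewrite comm3_inv comm3Ml invgM -!comm3_inv.
by apply: (commute_sym (class3 _ _ _ _)).
Qed.

Lemma comm3Vm x y z : [~ x, y^-1, z] = [~ x, y, z]^-1.
Proof.
by apply: (mulgI [~ x, y, z]); rewrite -comm3Mm !mulgV commg1 comm1g.
Qed.

(** This is [Hall_Witt] with trivial conjugations; the inverse in each middle slot inverts the whole
    factor. *)
Lemma comm3_Jacobi x y z : [~ x, y, z] * [~ y, z, x] * [~ z, x, y] = 1.
Proof.
have := Hall_Witt x y z; rewrite !comm3Vm !conjVg !J3 -!invgM.
move/eqP; rewrite invg_eq1 => /eqP <-.
by rewrite [RHS](class3 z x y) (class3 y z x).
Qed.

(** Taking commutators of [[~ x, y]] with a variable element is a homomorphism into the centre,
    which kills [[~ z, w]]. *)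
Lemma comm22_commute x y z w : commute [~ x, y] [~ z, w].
Proof.
apply/commute1P; have -> : [~ z, w] = z^-1 * (w^-1 * (z * w)) by [].
rewrite 3!comm3Mr 2!comm3Vr.
by rewrite (class3 x y z) mulKg mulVg.
Qed.

Lemma commXg_class3 x y k :
  [~ x ^+ k, y] = [~ x, y] ^+ k * [~ x, y, x] ^+ 'C(k, 2).
Proof.
elim: k => [|k IH]; first by rewrite comm1g mulg1.
rewrite expgS commMgJ_group IH binS bin1 expgnDr mulgA.
have -> : [~ x, y] ^ (x ^+ k) = [~ x, y] * [~ x, y, x] ^+ k.
  by rewrite -comm3Xr [in RHS]commgEl mulVKg.
rewrite expgS -!mulgA; congr (_ * _).
rewrite [[~ x, y] ^+ k * (_ * _)]mulgA.
have hc w m : commute ([~ x, y, x] ^+ m) w.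
  by apply/commute_sym/commuteX/commute_sym/class3.
by rewrite hc -!mulgA; congr (_ * _).
Qed.

(** For odd [p] the binomial ['C(p, 2)] is a multiple of [p], and [[~ x, y, x] ^+ p =
    [~ x, y, x ^+ p] = 1], so the correction term of [commXg_class3] vanishes, also for [p = 3]. *)
Lemma comm_expg_odd x y p : odd p -> x ^+ p = 1 -> [~ x, y] ^+ p = 1.
Proof.
move=> p_odd xp; have := commXg_class3 x y p.
rewrite xp comm1g bin2odd // expgnA -comm3Xr xp commg1 expg1n mulg1.
by move<-.
Qed.

End ClassThree.

(** * Families of commuting elements of order p *)

Lemma expg_modn (G : groupType) (x : G) m k :
  x ^+ m = 1 -> x ^+ (k %% m) = x ^+ k.
Proof.
by move=> xm; rewrite [in RHS](divn_eq k m) expgnDr mulnC expgnA xm expg1n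
  mul1g.
Qed.

Lemma piv_eq0 (K : fieldType) (E : vectType K) (J : {vspace E}) (v : E) :
  (piv J v == 0%R) = (v \in J).
Proof. by rewrite -memv_ker lker_piv. Qed.

(** A scalar of ['F_p] acts as an iterated sum, so a set of values containing 0 and closed under
    addition is already a subspace. *)
Lemma mem_sum_lines (p : nat) (E : vectType 'F_p) (T : finType) (Q : pred T)
    (f : T -> E) (v : E) :
    (exists2 s, Q s & f s = 0%R) ->
    (forall s t, Q s -> Q t -> exists2 u, Q u & f u = (f s + f t)%R) ->
  reflect (exists2 s, Q s & v = f s) (v \in \sum_(s | Q s) <[f s]>)%VS.
Proof.
move=> Q0 QD; apply: (iffP memv_sumP) => [[w hw ->]|[s Qs ->]]; last first.
  exists (fun t => if t == s then f s else 0%R) => [t Qt|].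
    by case: eqP => [->|_]; rewrite ?memv_line ?mem0v.
  by rewrite -big_mkcondr (big_pred1 s) // => t;
    rewrite andbC andb_idr // => /eqP->.
have hsum (u u' : E) :
    (exists2 s, Q s & u = f s) -> (exists2 s, Q s & u' = f s) ->
    exists2 s, Q s & (u + u')%R = f s.
  by move=> [s Qs ->] [t Qt ->]; have [r Qr <-] := QD _ _ Qs Qt; exists r.
have h0 : exists2 s, Q s & 0%R = f s by case: Q0 => s Qs <-; exists s.
elim/big_ind: _ => // s Qs; case/vlineP: (hw s Qs) => k ->.
rewrite -[k]natr_Zp scaler_nat; elim: (k : nat) => [|m IH].
  by rewrite mulr0n.
by rewrite mulrS; apply: hsum => //; exists s.
Qed.

Section ElementaryAbelian.

Variables (p : nat) (p_prime : prime p).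
Implicit Types (a b : 'F_p).

Lemma expg_FpD (G : groupType) (x : G) a b :
  x ^+ p = 1 -> x ^+ (a + b)%R = x ^+ a * x ^+ b.
Proof.
move=> xp; have -> : (a + b)%R = ((a + b) %% p)%N :> nat.
  exact: (congr1 (fun m => (val a + val b) %% m)%N (Fp_cast p_prime)).
by rewrite expg_modn // expgnDr.
Qed.

Section Family.

Variables (G : groupType) (I : finType) (x : I -> G).
Hypothesis xp : forall i, x i ^+ p = 1.
Hypothesis xC : forall i j, commute (x i) (x j).

Definition prodX (t : {ffun I -> 'F_p}) : G := \prod_i x i ^+ t i.

Lemma prodXD t u : prodX (t + u)%R = prodX t * prodX u.
Proof.
rewrite -prodgM_commute; last by move=> i j *; apply: commuteX2.
by apply: eq_bigr => i _; rewrite ffunE expg_FpD.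
Qed.

Lemma prodX0 : prodX 0%R = 1.
Proof. by apply: (mulgI (prodX 0%R)); rewrite -prodXD addr0 mulg1. Qed.

Lemma prodX_delta i a : prodX [ffun j => if j == i then a else 0%R] = x i ^+ a.
Proof.
rewrite /prodX (eq_bigr (fun j => if j == i then x i ^+ a else 1)) => [|j _].
  by rewrite -big_mkcond big_pred1_eq.
by rewrite ffunE; case: eqP => [->|].
Qed.

(** [L] is the projection modulo the subspace of relations among the [x i]. It turns identities
    between commuting elements of order p into linear algebra. *)
Lemma prodX_linear : exists (E : vectType 'F_p)
    (L : {linear {ffun I -> ('F_p)^o} -> E}),
  forall t : {ffun I -> 'F_p}, prodX t = 1 <-> L t = 0%R.
Proof.
pose A : vectType 'F_p := {ffun I -> ('F_p)^o}.
pose K : {vspace A} :=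
  (\sum_(t : {ffun I -> 'F_p} | prodX t == 1%g) <[t : A]>)%VS.
exists (quotv K), (piv K) => t.
rewrite (_ : (piv K t = 0)%R <-> (t : A) \in K); last first.
  by rewrite -piv_eq0; split=> [->|/eqP].
have hK := @mem_sum_lines _ A {ffun I -> 'F_p} (fun s => prodX s == 1)
  (fun s => s : A) t.
have h0 : exists2 s, prodX s == 1 & (s : A) = 0%R by exists 0%R;
  rewrite ?prodX0.
have {hK}hK := hK h0 _.
split=> [t1|].
  apply/hK => [s u /eqP s1 /eqP u1|]; last by exists t; rewrite ?t1.
  by exists (s + u)%R; rewrite ?prodXD ?s1 ?u1 ?mulg1.
case/hK => [s u /eqP s1 /eqP u1|s /eqP s1 -> //].
by exists (s + u)%R; rewrite ?prodXD ?s1 ?u1 ?mulg1.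
Qed.

End Family.

Section Triangular.

Variables (n : nat) (G : groupType) (c : 'I_n -> 'I_n -> G).
Implicit Types (t u : 'M['F_p]_n).

(** The index pattern is that of [C_elt], which becomes an instance by conversion. *)
Definition prod_lt t : G :=
  \prod_(i < n) \prod_(j < n | (i < j)%N) c j i ^+ t i j.

Hypothesis cp : forall i j, c i j ^+ p = 1.
Hypothesis cC : forall i j k l, commute (c i j) (c k l).

Lemma prod_ltD t u : prod_lt (t + u)%R = prod_lt t * prod_lt u.
Proof.
rewrite -prodgM_commute => [|i i' _ _]; last first.
  by apply: commute_prod => j' _; apply/commute_sym/commute_prod => j _;
    apply: commuteX2.
apply: eq_bigr => i _; rewrite -prodgM_commute => [|j j' _ _];
  last exact: commuteX2.
by apply: eq_bigr => j _; rewrite mxE expg_FpD.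
Qed.

Lemma prod_lt0 : prod_lt 0%R = 1.
Proof. by apply: (mulgI (prod_lt 0%R)); rewrite -prod_ltD addr0 mulg1. Qed.

Lemma prod_ltN t : prod_lt (- t)%R = (prod_lt t)^-1.
Proof.
by apply: (mulgI (prod_lt t)); rewrite -prod_ltD subrr prod_lt0 mulgV.
Qed.

End Triangular.

Lemma mult_prod_lt n (G H : groupType) (f : {multiplicative G -> H})
    (c : 'I_n -> 'I_n -> G) (t : 'M['F_p]_n) :
  f (prod_lt c t) = prod_lt (fun i j => f (c i j)) t.
Proof.
rewrite mult_prod; apply: eq_bigr => i _; rewrite mult_prod.
by apply: eq_bigr => j _; rewrite multX.
Qed.

Lemma prod_lt_delta n (G : groupType) (c : 'I_n -> 'I_n -> G) (i j : 'I_n) :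
  (i < j)%N -> prod_lt c (delta_mx i j : 'M['F_p]_n) = c j i.
Proof.
move=> ij; rewrite /prod_lt (eq_bigr (fun i' => if i' == i then c j i else 1)).
  by rewrite -big_mkcond big_pred1_eq.
move=> i' _; case: eqP => [->|/eqP/negPf ii]; last first.
  by rewrite big1 // => j' _; rewrite mxE ii.
rewrite (eq_bigr (fun j' => if j' == j then c j i else 1)) => [|j' _].
  by rewrite -big_mkcondr (big_pred1 j) // => j';
    rewrite andbC andb_idr // => /eqP->.
by rewrite mxE eqxx /=; case: eqP => [->|].
Qed.

Lemma eq_prod_lt n (G : groupType) (c : 'I_n -> 'I_n -> G) (t u : 'M['F_p]_n) :
  (forall i j : 'I_n, (i < j)%N -> t i j = u i j) -> prod_lt c t = prod_lt c u.
Proof.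
by move=> tu; apply: eq_bigr => i _; apply: eq_bigr => j ij; rewrite tu.
Qed.

Lemma commg_prod_lt n (G : groupType) (c : 'I_n -> 'I_n -> G)
    (t : 'M['F_p]_n) z :
    (forall i j w, commute [~ c i j, z] w) ->
  [~ prod_lt c t, z] = prod_lt (fun i j => [~ c i j, z]) t.
Proof.
move=> h; have hX i j (k : nat) w : commute [~ c j i ^+ k, z] w.
  by rewrite commgX_central //; apply/commute_sym/commuteX/commute_sym.
rewrite commg_prod_central => [|i w].
  apply: eq_bigr => i _; rewrite commg_prod_central //.
  by apply: eq_bigr => j _; rewrite commgX_central.
rewrite commg_prod_central //.
by apply/commute_sym/commute_prod => j _; apply/commute_sym.
Qed.

End ElementaryAbelian.

(** * Maps out of V and W *)

Local Open Scope ring_scope.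

(** Compose [f] with a right inverse of the surjection [piv J]: two preimages of a class differ by
    an element of [J], which [f] kills. *)
Lemma quotv_lift (K : fieldType) (E E' : vectType K) (J : {vspace E})
    (f : 'Hom(E, E')) :
  (J <= lker f)%VS ->
  exists f' : 'Hom(quotv J, E'), forall x, f' (piv J x) = f x.
Proof.
move=> Jf; exists (f \o (piv J)^-1)%VF => x; rewrite comp_lfunE.
apply/eqP; rewrite -subr_eq0 -linearB -memv_ker; apply: (subvP Jf).
by rewrite -piv_eq0 linearB /= limg_lfunVK ?subrr // limg_piv memvf.
Qed.

(** * Bilinear maps and the tensor product *)

Section TensorLift.

Variables (K : fieldType) (A B E : vectType K) (h : A -> B -> E).

Definition tensor_lift_fun (M : tensor A B) : E :=
  \sum_i \sum_j M i j *: h (vbasis {:A})`_i (vbasis {:B})`_j.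

Lemma tensor_lift_linear : linear tensor_lift_fun.
Proof.
move=> k M N; rewrite /tensor_lift_fun scaler_sumr -big_split /=.
apply: eq_bigr => i _; rewrite scaler_sumr -big_split /=.
by apply: eq_bigr => j _; rewrite !mxE scalerDl scalerA.
Qed.
HB.instance Definition _ :=
  GRing.isLinear.Build K (tensor A B) E _ tensor_lift_fun tensor_lift_linear.

Lemma tensor_lift : (forall b, linear (h^~ b)) -> (forall a, linear (h a)) ->
  exists f : 'Hom(tensor A B, E), forall a b, f (tens a b) = h a b.
Proof.
move=> hl hr; exists (linfun tensor_lift_fun) => a b; rewrite lfunE /=.
pose gl b : {linear A -> E} := HB.pack (h^~ b) (GRing.isLinear.Build K A E _
  (h^~ b) (hl b)).
pose gr a : {linear B -> E} := HB.pack (h a) (GRing.isLinear.Build K B E _ (h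
  a) (hr a)).
rewrite /tensor_lift_fun [in RHS](coord_vbasis (memvf a)) -[RHS]/(gl b _)
  linear_sum.
apply: eq_bigr => i _; rewrite linearZ /=.
rewrite {2}(coord_vbasis (memvf b)) -[h _ _]/(gr _ _) linear_sum scaler_sumr.
by apply: eq_bigr => j _; rewrite linearZ /= mxE scalerA.
Qed.

End TensorLift.

Section TriangularSum.

Variables (p n : nat) (E : lmodType 'F_p) (c : 'I_n -> 'I_n -> E).
Implicit Types s t : 'M['F_p]_n.

Definition sum_lt s : E := \sum_(i < n) \sum_(j < n | (i < j)%N) s i j *: c j i.

Lemma sum_lt_linear : linear sum_lt.
Proof.
move=> k s t; rewrite /sum_lt scaler_sumr -big_split; apply: eq_bigr => i _.
rewrite scaler_sumr -big_split; apply: eq_bigr => j _ /=.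
by rewrite !mxE scalerDl scalerA.
Qed.
HB.instance Definition _ :=
  GRing.isLinear.Build 'F_p 'M['F_p]_n E _ sum_lt sum_lt_linear.

Lemma sum_lt_delta (i j : 'I_n) : (i < j)%N -> sum_lt (delta_mx i j) = c j i.
Proof.
move=> ij; rewrite /sum_lt (bigD1 i) //= (bigD1 j) //= !mxE !eqxx scale1r.
rewrite [X in _ + X + _]big1 => [|j' /andP[_ /negPf jj]]; last first.
  by rewrite mxE jj andbF scale0r.
rewrite big1 ?addr0 // => i' /negPf ii; rewrite big1 // => j' _.
by rewrite mxE ii scale0r.
Qed.

End TriangularSum.

Lemma linear_sum_lt p n (E E' : lmodType 'F_p) (f : {linear E -> E'})
    (c : 'I_n -> 'I_n -> E) (s : 'M['F_p]_n) :
  f (sum_lt c s) = sum_lt (fun j i => f (c j i)) s.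
Proof.
rewrite linear_sum; apply: eq_bigr => i _; rewrite linear_sum.
by apply: eq_bigr => j _; rewrite linearZ.
Qed.

(** Brings a triangular product into the form [prodX] of a linear combination of coordinate vectors,
    to which [prodX_linear] applies. *)
Lemma prodX_sum_lt p n (p_prime : prime p) (G : groupType) (I : finType)
    (x : I -> G)
    (e : 'I_n -> 'I_n -> I) (s : 'M['F_p]_n) :
    (forall i, x i ^+ p = 1)%g -> (forall i j, commute (x i) (x j)) ->
  prodX x (sum_lt (fun j i => [ffun k => (k == e j i)%:R : ('F_p)^o]) s)
    = prod_lt (fun j i => x (e j i)) s.
Proof.
move=> xp xC; rewrite /sum_lt.
rewrite (big_morph _ (prodXD p_prime xp xC) (prodX0 p_prime xp xC)).
apply: eq_bigr => i _.
rewrite (big_morph _ (prodXD p_prime xp xC) (prodX0 p_prime xp xC)).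
apply: eq_bigr => j _; rewrite -prodX_delta; congr prodX; apply/ffunP => k.
by rewrite !ffunE; case: eqP => _; [apply: mulr1|apply: mulr0].
Qed.

(** * Identities and spanning sets in V and W *)

Section Wedge.

Variables (p n : nat).
Local Notation U := (U p n).
Local Notation V := (V p n).
Local Notation W := (W p n).
Implicit Types (a b c u : U) (v : V).

Lemma U_expand a : a = \sum_i a 0 i *: ub p i.
Proof. exact: row_sum_delta. Qed.

(** Flipping the arguments lets linearity in the left factor be declared as a structure; [phil] does
    the same for the index of [phi]. *)
Definition wedger b a : V := wedge a b.
Lemma wedger_linear b : linear (wedger b).
Proof. by move=> k a a'; rewrite /wedger /wedge tens_linearl linearP. Qed.
HB.instance Definition _ b :=
  GRing.isLinear.Build 'F_p U V _ (wedger b) (wedger_linear b).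

Lemma wedge_linear a : linear (wedge a).
Proof. by move=> k b b'; rewrite /wedge tens_linearr linearP. Qed.
HB.instance Definition _ a :=
  GRing.isLinear.Build 'F_p U V _ (wedge a) (wedge_linear a).

Lemma wedge_alt a : wedge a a = 0.
Proof.
apply/eqP; rewrite piv_eq0; apply: (subvP (sumv_sup a _ (subvv _))) => //.
exact: memv_line.
Qed.

Lemma wedge_anti a b : wedge a b = - wedge b a.
Proof.
apply/eqP; rewrite -addr_eq0; apply/eqP; have := wedge_alt (a + b).
have -> : wedge (a + b) (a + b) = wedge a (a + b) + wedge b (a + b).
  exact: (linearD (wedger (a + b))).
by rewrite !linearD /= !wedge_alt add0r addr0.
Qed.

Definition bracket a b c : W := phi c (wedge a b).

Lemma bracket_Jacobi a b c : bracket a b c + bracket b c a + bracket c a b = 0.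
Proof.
rewrite /bracket !phiE -!linearD; apply/eqP; rewrite piv_eq0.
apply: (subvP (sumv_sup a _ (sumv_sup b _ (sumv_sup c _ (subvv _))))) => //.
exact: memv_line.
Qed.

Lemma bracket_anti a b c : bracket a b c = - bracket b a c.
Proof. by rewrite /bracket wedge_anti linearN. Qed.

Lemma bracket_alt a b : bracket a a b = 0.
Proof. by rewrite /bracket wedge_alt linear0. Qed.

Definition phil v u : W := phi u v.
Lemma phil_linear v : linear (phil v).
Proof. by move=> k a b; rewrite /phil !phiE tens_linearr linearP. Qed.
HB.instance Definition _ v :=
  GRing.isLinear.Build 'F_p U W _ (phil v) (phil_linear v).

Lemma phi_expand u v : phi u v = \sum_k u 0 k *: phi (ub p k) v.
Proof.
rewrite {1}(U_expand u) -/(phil v _) linear_sum.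
by apply: eq_bigr => k _; rewrite linearZ.
Qed.

Lemma wedge_expand a b :
  wedge a b = \sum_i \sum_j (a 0 i * b 0 j) *: wedge (ub p i) (ub p j).
Proof.
rewrite {1}(U_expand a) -/(wedger b _) linear_sum.
apply: eq_bigr => i _; rewrite linearZ /= /wedger.
rewrite {1}(U_expand b) linear_sum scaler_sumr.
by apply: eq_bigr => j _; rewrite linearZ scalerA.
Qed.

Lemma V_eltE (s : 'M['F_p]_n) :
  V_elt s = sum_lt (fun j i => wedge (ub p j) (ub p i)) s.
Proof. by []. Qed.

(** The values of [V_elt] form a subspace, and it contains every wedge since [wedge] is alternating.
    V is the image of the matrix units, which are pure tensors of basis vectors. *)
Lemma V_elt_surj v : exists s, v = V_elt s.
Proof.
pose S v := exists s : 'M['F_p]_n, v = V_elt s.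
have S0 : S 0 by exists 0; rewrite V_eltE linear0.
have SD x y : S x -> S y -> S (x + y).
  by move=> [s ->] [t ->]; exists (s + t); rewrite !V_eltE linearD.
have SZ k x : S x -> S (k *: x) by move=> [s ->]; exists (k *: s);
  rewrite !V_eltE linearZ.
have Sw a b : S (wedge a b).
  rewrite wedge_expand; elim/big_ind: _ => // i _; elim/big_ind: _ => // j _.
  apply: (SZ); case: (ltngtP i j) => [ij|ij|/ord_inj->];
    last by rewrite wedge_alt.
    by rewrite wedge_anti -scaleN1r; apply: SZ; exists (delta_mx i j);
      rewrite V_eltE sum_lt_delta.
  by exists (delta_mx j i); rewrite V_eltE sum_lt_delta.
have := memvf v; rewrite -limg_piv => /memv_imgP[M _ ->].
rewrite [M]matrix_sum_delta linear_sum; elim/big_ind: _ => // i _.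
rewrite linear_sum; elim/big_ind: _ => // j _; rewrite linearZ; apply: SZ.
suff -> : delta_mx i j = tens (vbasis {:U})`_i (vbasis {:U})`_j by apply: Sw.
apply/matrixP => k l; rewrite !mxE !coord_free ?(basis_free (vbasisP _)) //.
by rewrite -natrM mulnb (eq_sym k) (eq_sym l).
Qed.

End Wedge.

Lemma sum3_rot (I : finType) (E : nmodType) (F : I -> I -> I -> E) :
  \sum_i \sum_j \sum_k F i j k = \sum_i \sum_j \sum_k F j k i.
Proof.
rewrite [RHS]exchange_big /=; apply: eq_bigr => i _.
by rewrite [RHS]exchange_big.
Qed.

Lemma sum_ub1 p n (E : lmodType 'F_p) (T : 'I_n -> E) (i0 : 'I_n) :
  \sum_i (ub p i0) 0 i *: T i = T i0.
Proof.
rewrite (bigD1 i0) //= big1 => [|i /negPf ii]; rewrite !mxE ?ii ?scale0r //.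
by rewrite !eqxx scale1r addr0.
Qed.

Lemma sum_ub2 p n (E : lmodType 'F_p) (T : 'I_n -> 'I_n -> E) (i0 j0 : 'I_n) :
  \sum_i \sum_j ((ub p i0) 0 i * (ub p j0) 0 j) *: T i j = T i0 j0.
Proof.
rewrite -[RHS](sum_ub1 (T^~ j0)); apply: eq_bigr => i _.
rewrite -[T i j0](sum_ub1 (T i)) scaler_sumr.
by apply: eq_bigr => j _; rewrite scalerA.
Qed.

Lemma sum_ub3 p n (E : lmodType 'F_p) (T : 'I_n -> 'I_n -> 'I_n -> E) (i0 j0 k0
  : 'I_n) :
  \sum_i \sum_j \sum_k ((ub p i0) 0 i * (ub p j0) 0 j * (ub p k0) 0 k) *:
    T i j k
    = T i0 j0 k0.
Proof.
rewrite -[RHS](sum_ub2 (fun i j => T i j k0)); apply: eq_bigr => i _.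
apply: eq_bigr => j _; rewrite -[T i j k0](sum_ub1 (T i j)) scaler_sumr.
by apply: eq_bigr => k _; rewrite scalerA.
Qed.

(** * Universal properties of V and W for odd p *)

Section Lifting.

Variables (p n : nat) (p_prime : prime p) (p_odd : odd p) (E : vectType 'F_p).
Local Notation V := (V p n).
Local Notation W := (W p n).

Lemma eqNr0 (x : E) : x = - x -> x = 0.
Proof.
move/eqP; rewrite -addr_eq0 -mulr2n -scaler_nat scaler_eq0 => /orP[|/eqP//].
rewrite -(dvdn_pcharf (pchar_Fp p_prime)) => /dvdn_leq => /(_ isT).
by rewrite leqNgt odd_prime_gt2.
Qed.

Lemma wedge_lift (T : 'I_n -> 'I_n -> E) : (forall i j, T i j = - T j i) ->
  exists f : 'Hom(V, E), forall a b : U p n,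
    f (wedge a b) = \sum_i \sum_j (a 0 i * b 0 j) *: T i j.
Proof.
move=> TN; pose h (a b : U p n) := \sum_i \sum_j (a 0 i * b 0 j) *: T i j.
have [||f fE] := @tensor_lift _ _ _ _ h.
- move=> b k x y; rewrite /h scaler_sumr -big_split; apply: eq_bigr => i _ /=.
  rewrite scaler_sumr -big_split; apply: eq_bigr => j _ /=.
  by rewrite !mxE mulrDl scalerDl scalerA mulrA.
- move=> a k x y; rewrite /h scaler_sumr -big_split; apply: eq_bigr => i _ /=.
  rewrite scaler_sumr -big_split; apply: eq_bigr => j _ /=.
  by rewrite !mxE mulrDr scalerDl mulrCA scalerA.
have [|f' f'E] := @quotv_lift _ _ _ (\sum_(a : 'rV['F_p]_n) <[tens (a : U p n)
  (a : U p n)]>)%VS f.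
  (* Antisymmetry of [T] only makes the value on [tens a a] equal to its own negative; it is 0
     because 2 is invertible. *)
  apply/subv_sumP => a _; rewrite -memvE memv_ker fE; apply/eqP/eqNr0.
  rewrite {1}/h exchange_big /= -sumrN; apply: eq_bigr => i _.
  by rewrite -sumrN; apply: eq_bigr => j _; rewrite TN scalerN mulrC.
by exists f' => a b; rewrite f'E fE.
Qed.

(** W is presented by the brackets of basis vectors subject to antisymmetry and Jacobi: for each [k]
    lift to V, then extend linearly in the last vector and check that [J] is killed. *)
Lemma bracket_lift (T : 'I_n -> 'I_n -> 'I_n -> E) :
    (forall i j k, T i j k = - T j i k) ->
    (forall i j k, T i j k + T j k i + T k i j = 0) ->
  exists f : 'Hom(W, E), forall i j k,
    f (bracket (ub p i) (ub p j) (ub p k)) = T i j k.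
Proof.
move=> TN TJ.
have /choice[g gE] k := wedge_lift (fun i j => TN i j k).
pose h (v : V) (u : U p n) := \sum_k u 0 k *: g k v.
have [||f fE] := @tensor_lift _ _ _ _ h.
- move=> b k x y; rewrite /h scaler_sumr -big_split; apply: eq_bigr => i _ /=.
  by rewrite linearP scalerDr !scalerA mulrC.
- move=> a k x y; rewrite /h scaler_sumr -big_split; apply: eq_bigr => i _ /=.
  by rewrite !mxE scalerDl scalerA.
pose t (a b c : U p n) :=
  \sum_i \sum_j \sum_k (a 0 i * b 0 j * c 0 k) *: T i j k.
have hE a b c : h (wedge a b) c = t a b c.
  rewrite /h /t; under eq_bigr do rewrite gE scaler_sumr.
  rewrite exchange_big; apply: eq_bigr => i _ /=.
  under eq_bigr do rewrite scaler_sumr.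
  rewrite exchange_big; apply: eq_bigr => j _ /=.
  by apply: eq_bigr => k _; rewrite scalerA mulrC.
have [|f' f'E] := @quotv_lift _ _ _ (J p n) f.
  apply/subv_sumP => a _; apply/subv_sumP => b _; apply/subv_sumP => c _;
    rewrite -memvE memv_ker !linearD /= !fE !hE.
  (* The two rotated sums are reindexed so that all three carry the same coefficient at (i, j, k);
     Jacobi for [T] then cancels them termwise. *)
  have -> : t b c a = \sum_i \sum_j \sum_k (b 0 j * c 0 k * a 0 i) *: T j k i.
    by rewrite /t sum3_rot.
  have -> : t c a b = \sum_i \sum_j \sum_k (c 0 k * a 0 i * b 0 j) *: T k i j.
    by rewrite /t 2!sum3_rot.
  rewrite /t -!big_split big1 // => i _ /=.
  rewrite -!big_split big1 // => j _ /=; rewrite -!big_split big1 // => k _ /=.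
  rewrite (mulrC (b 0 j * c 0 k)) mulrA -(mulrA (c 0 k)) (mulrC (c 0 k)).
  by rewrite -!scalerDr TJ scaler0.
exists f' => i j k; rewrite /bracket phiE f'E fE hE /t.
exact: sum_ub3.
Qed.

End Lifting.

Local Open Scope group_scope.

(** * The universal property of the 3-nilpotent product *)

Section Quotients.

Variables (G : groupType) (N : normal_sub G).

Lemma coset_eq1 x : coset N x = 1 <-> (N : set G) x.
Proof.
rewrite -(mult1 (coset N)) cosetE mulg1.
have hN := (normal_setP N).1.
by split=> /(subgroupV hN); rewrite ?invgK.
Qed.

Lemma coset_surj (y : quotg N) : exists x, y = coset N x.
Proof. by exists (repr y); rewrite /coset reprK. Qed.

Lemma quotg_lift (H : groupType) (f : {multiplicative G -> H}) :
    (forall x, (N : set G) x -> f x = 1) ->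
  exists f' : {multiplicative quotg N -> H}, forall x, f' (coset N x) = f x.
Proof.
move=> fN; pose f' (y : quotg N) := f (repr y).
have f'E x : f' (coset N x) = f x.
  have : coset N (repr (coset N x)) = coset N x by rewrite /coset reprK.
  by move/cosetE/fN; rewrite gmulfM multV => h;
    apply: (mulgI (f' (coset N x))^-1); rewrite mulVg h.
have f'M : {morph f' : x y / x * y}.
  move=> a b; have [x ->] := coset_surj a; have [y ->] := coset_surj b.
  by rewrite -gmulfM !f'E gmulfM.
pose g : {multiplicative quotg N -> H} :=
  HB.pack f' (isMultiplicative.Build _ _ f' f'M).
by exists g.
Qed.

End Quotients.

Section FreeProductTheory.

Variables (I : choiceType) (A : I -> groupType).

Lemma fp_inM (i : I) (a b : A i) : fp_in (a * b) = fp_in a * fp_in b.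
Proof.
rewrite /fp_in; apply/fp_classE; apply: fp_trans (fp_sym (fp_mul a b)) _.
rewrite -[[:: _; _]]/([:: mkletter a] ++ [:: mkletter b]).
by apply: fp_cat; apply/fp_classE; rewrite /fp_class reprK.
Qed.

Lemma fp_in1 (i : I) : fp_in (1 : A i) = 1.
Proof. exact/fp_classE/fp_one. Qed.

Lemma fp_inX (i : I) (a : A i) k : fp_in (a ^+ k) = fp_in a ^+ k.
Proof. by elim: k => [|k IH]; rewrite ?fp_in1 // !expgS fp_inM IH. Qed.

Lemma fp_class_cons l w : fp_class (l :: w) = @fp_in I A (projT1 l) (projT2 l)
  * fp_class w.
Proof.
apply/fp_classE; rewrite -cat1s.
by apply: fp_cat; apply: fp_sym; apply/fp_classE; rewrite /fp_class reprK;
  case: l.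
Qed.

Lemma fp_lift (H : groupType) (f : forall i, {multiplicative A i -> H}) :
  exists F : {multiplicative free_product A -> H},
    forall i (a : A i), F (fp_in a) = f i a.
Proof.
pose ev (w : word A) := \prod_(l <- w) f (projT1 l) (projT2 l).
have ev_cong u w : fp_cong u w -> ev u = ev w.
  elim=> {u w} //; rewrite /ev.
  - by move=> u v w _ -> _ ->.
  - by move=> u u' w w' _ e _ e'; rewrite !big_cat /= e e'.
  - by move=> i; rewrite big_seq1 big_nil mult1.
  - by move=> i a b; rewrite !big_cons !big_nil !mulg1 gmulfM.
pose F (x : free_product A) := ev (repr x).
have FE w : F (fp_class w) = ev w by apply/ev_cong/fp_classE;
  rewrite /fp_class reprK.
have FM : {morph F : x y / x * y}.
  by move=> x y; rewrite [LHS]FE /ev big_cat.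
pose g : {multiplicative free_product A -> H} :=
  HB.pack F (isMultiplicative.Build _ _ F FM).
exists g => i a; rewrite /g /=.
by rewrite FE /ev big_seq1.
Qed.

End FreeProductTheory.

Section ThreeNilpotentProduct.

Variables (p n : nat).
Local Notation F := (F3 p n).
Local Notation x := (@F3_gen p n).

Lemma cyclic_family_exp (i : 'I_n) (a : cyclic_family p i) :
  a = (1%R : cyclic_family p i) ^+ (a : 'Z_p).
Proof. by rewrite -[LHS]Zp1_expgz. Qed.

(** Inverses of generators need no case, since each cyclic factor consists of nonnegative powers of
    its generator. *)
Lemma F3_ind (P : F -> Prop) :
  P 1 -> (forall k z, P z -> P (x k * z)) -> forall z, P z.
Proof.
move=> P1 PM z; have [w ->] := coset_surj z; rewrite -[w]reprK.
elim: (repr w) => [|[i a] u IH];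
  first by rewrite [coset _ _](mult1 (coset (lcsN (free_product (@cyclic_family
  p n)) 4))).
rewrite -/(fp_class _) fp_class_cons gmulfM /= (cyclic_family_exp a) fp_inX
  multX.
rewrite -/(x i).
elim: (a : nat) => [|k IHk]; first by rewrite mul1g.
by rewrite expgS -mulgA; apply: PM.
Qed.

Lemma F3_subgroup_full (A : set F) :
  subgroup A -> (forall k, A (x k)) -> forall z, A z.
Proof. by move=> hA hx; apply: F3_ind => [|k z];
  [apply: hA.1|apply: subgroupM]. Qed.

Lemma F3_class3 (a b c d : F) : commute [~ a, b, c] d.
Proof.
have [a' ->] := coset_surj a; have [b' ->] := coset_surj b.
have [c' ->] := coset_surj c; have [d' ->] := coset_surj d.
apply/commute1P.
rewrite -(multR _ a' b') -(multR _ [~ a', b'] c') -(multR _ [~ a', b', c'] d').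
by apply/coset_eq1; exact: (@lcsS _ 2 _ _ (@lcsS _ 1 _ _ (@lcsS _ 0 _ _ (lcs1
  a')))).
Qed.

Lemma F3_gen_exp i : prime p -> x i ^+ p = 1.
Proof.
move=> p_prime; rewrite -multX -fp_inX.
have -> : (1%R : cyclic_family p i) ^+ p = 1; last by rewrite fp_in1 mult1.
have p_gt1 := prime_gt1 p_prime.
rewrite -[LHS]/((Zp1 : 'Z_p) ^+ p) Zp_expg; apply/val_inj => /=.
by rewrite Zp_cast // modnMl.
Qed.

(** The maps from the cyclic factors combine on the free product, whose fourth lower central term
    lands in that of [H]. Only the [h i] are asked to have trivial p-th power; for p = 3 the model
    used below need not have exponent p. *)
Lemma F3_lift (H : groupType) (h : 'I_n -> H) : prime p ->
    (forall z, lcs H 4 z -> z = 1) -> (forall i, h i ^+ p = 1) ->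
  exists f : {multiplicative F -> H}, forall i, f (x i) = h i.
Proof.
move=> p_prime H4 hp; have p_gt1 := prime_gt1 p_prime.
have fM i :
    {morph (fun a : cyclic_family p i => h i ^+ (a : 'Z_p)) : a b / a * b}.
  move=> a b; rewrite -expgnDr -[RHS](expg_modn _ (hp i)).
  by rewrite -[X in _ = _ ^+ (_ %% X)](Zp_cast p_gt1).
pose f i : {multiplicative cyclic_family p i -> H} :=
  HB.pack (fun a : cyclic_family p i => h i ^+ (a : 'Z_p))
    (isMultiplicative.Build _ _ _ (fM i)).
have [g gE] := fp_lift f.
have [|g' g'E] := @quotg_lift _ (lcsN _ 4) _ g.
  by move=> z hz; apply: H4; apply: lcs_morph.
exists g' => i; rewrite g'E gE /=.
by rewrite /= modn_small.
Qed.

End ThreeNilpotentProduct.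

(** * Normal forms and the truncated tensor model *)

Section NormalForm.

Variables (p n : nat) (p_prime : prime p) (p_odd : odd p).
Local Notation F := (F3 p n).
Local Notation x := (@F3_gen p n).
Implicit Types (s t : 'M['F_p]_n) (y z : F).

Let c i j : F := [~ x i, x j].

Lemma F3_comm_exp i j : c i j ^+ p = 1.
Proof. exact: (comm_expg_odd (@F3_class3 p n)) p_odd (F3_gen_exp _ p_prime).
  Qed.

Lemma F3_comm_commute i j k l : commute (c i j) (c k l).
Proof. exact: (comm22_commute (@F3_class3 p n)). Qed.

Lemma C_eltE s : C_elt s = prod_lt c s.
Proof. by []. Qed.

Lemma C_eltD s t : C_elt (s + t)%R = C_elt s * C_elt t.
Proof. exact: (prod_ltD p_prime F3_comm_exp F3_comm_commute). Qed.

Lemma C_elt0 : C_elt (0%R : 'M['F_p]_n) = 1.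
Proof. exact: (prod_lt0 p_prime F3_comm_exp F3_comm_commute). Qed.

Lemma C_eltN s : C_elt (- s)%R = (C_elt s)^-1.
Proof. exact: (prod_ltN p_prime F3_comm_exp F3_comm_commute). Qed.

Lemma C_elt_delta (i j : 'I_n) : (i < j)%N -> C_elt (delta_mx i j) = c j i.
Proof. exact: prod_lt_delta. Qed.

Lemma C_elt_subgroup : subgroup [set z | exists s, z = C_elt s]%classic.
Proof.
split; first by exists 0%R; rewrite C_elt0.
by move=> _ _ [s ->] [t ->]; exists (s - t)%R; rewrite C_eltD C_eltN.
Qed.

Lemma F3_C_elt z : @F3_C p n z -> exists s, z = C_elt s.
Proof.
apply: gen_sub C_elt_subgroup _ z => _ [i [j [ij ->]]].
by exists (delta_mx i j); rewrite C_elt_delta.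
Qed.

(** Modulo F_3 conjugation fixes every commutator, so commutators are multiplicative in both
    arguments and reduce to pairs of generators. *)
Lemma lcs2_C_elt z : lcs F 2 z -> exists s f, lcs F 3 f /\ z = C_elt s * f.
Proof.
pose q := coset (lcsN F 3).
have qM a b : q (a * b) = q a * q b by exact: gmulfM.
have qV a : q a^-1 = (q a)^-1 by exact: multV.
pose D : set F := [set z | exists s, q z = q (C_elt s)]%classic.
have D_sub : subgroup D.
  split; first by exists 0%R; rewrite C_elt0.
  move=> a b [s sE] [t tE]; exists (s - t)%R.
  by rewrite C_eltD C_eltN !qM !qV sE tE.
have DJ a b y : D [~ a, b] -> D ([~ a, b] ^ y).
  case=> s sE; exists s; rewrite -sE; apply/esym/cosetE; rewrite -commgEl.
  exact: (@lcsS F 1 _ _ (@lcsS F 0 _ _ (lcs1 _))).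
suff DT a b : D [~ a, b].
  move=> hz; have [s /esym/cosetE hs] : D z.
    by apply: gen_sub hz => // _ [a [b [_ _ ->]]].
  by exists s, ((C_elt s)^-1 * z); split=> //; rewrite mulVKg.
have Dx k l : D [~ x k, x l].
  case: (ltngtP l k) => [lk|kl|/ord_inj->].
  - by exists (delta_mx l k); rewrite C_elt_delta.
  - rewrite -invgR; apply: subgroupV => //.
    by exists (delta_mx k l); rewrite C_elt_delta.
  - by rewrite commgg; apply: D_sub.1.
have Dxr l y : D [~ y, x l].
  elim/F3_ind: y => [|k y IH]; first by rewrite comm1g; apply: D_sub.1.
  by rewrite commMgJ_group; apply: subgroupM => //; apply: DJ.
elim/F3_ind: b => [|k y IH]; first by rewrite commg1; apply: D_sub.1.
by rewrite commgMJ_group; apply: subgroupM => //; apply: DJ.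
Qed.

End NormalForm.

(** * The truncated tensor algebra as a group *)

Section Model.

Variables (p n : nat) (Z : lmodType 'F_p) (R : 'I_n -> 'I_n -> 'I_n -> Z).
Implicit Types (a b : 'rV['F_p]_n) (S T : 'M['F_p]_n).
Local Open Scope ring_scope.

Definition tri (t : 'I_n -> 'I_n -> 'I_n -> 'F_p) : Z :=
  \sum_i \sum_j \sum_k t i j k *: R i j k.

Lemma triD t u : tri t + tri u = tri (fun i j k => t i j k + u i j k).
Proof.
rewrite /tri -big_split; apply: eq_bigr => i _.
rewrite -big_split; apply: eq_bigr => j _.
by rewrite -big_split; apply: eq_bigr => k _ /=; rewrite scalerDl.
Qed.

Lemma triZ m t : tri (fun i j k => m * t i j k) = m *: tri t.
Proof.
rewrite /tri scaler_sumr; apply: eq_bigr => i _; rewrite scaler_sumr.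
by apply: eq_bigr => j _; rewrite scaler_sumr; apply: eq_bigr => k _;
  rewrite scalerA.
Qed.

Lemma eq_tri t u : (forall i j k, t i j k = u i j k) -> tri t = tri u.
Proof.
by move=> e; do 3![apply: eq_bigr => ? _]; rewrite e.
Qed.

Lemma tri0 : tri (fun _ _ _ => 0) = 0.
Proof. by do 3![rewrite /tri big1 // => ? _]; rewrite scale0r. Qed.

Record model_data := Model { deg1 : 'rV['F_p]_n; deg2 : 'M['F_p]_n; deg3 : Z }.

(* The elements of constant term 1 in the tensor algebra of 'rV_n, truncated
   above degree 3 and with the degree 3 part pushed to Z by the linear map
   e_i e_j e_k |-> R i j k. *)
Definition model_of (_ : 'I_n -> 'I_n -> 'I_n -> Z) := model_data.
Local Notation model := (model_of R).

Definition model_tuple (m : model) := (deg1 m, deg2 m, deg3 m).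
Definition tuple_model u : model := Model u.1.1 u.1.2 u.2.
Lemma model_tupleK : cancel model_tuple tuple_model.
Proof. by case. Qed.
HB.instance Definition _ := Choice.copy model (can_type model_tupleK).

Definition outer a b : 'M['F_p]_n := \matrix_(i, j) (a 0 i * b 0 j).

Definition model_one : model := Model 0 0 0.
Definition model_mul (m m' : model) : model :=
  Model (deg1 m + deg1 m') (deg2 m + deg2 m' + outer (deg1 m) (deg1 m'))
    (deg3 m + deg3 m' +
     tri (fun i j k => deg1 m 0 i * deg2 m' j k + deg2 m i j * deg1 m' 0 k)).
(** Obtained by solving [m * m^-1 = 1] degree by degree. *)
Definition model_inv (m : model) : model :=
  let a := deg1 m in let S := outer a a - deg2 m in
  Model (- a) S
    (- deg3 m - tri (fun i j k => a 0 i * S j k - deg2 m i j * a 0 k)).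

Lemma model_mulA : associative model_mul.
Proof.
move=> [a S z] [b T y] [c Q w]; rewrite /model_mul /=; congr Model.
- exact: addrA.
- by apply/matrixP => i j; rewrite !mxE; ring.
rewrite (addrA z) (addrA z) (addrAC (z + y) _ w) -2!(addrA (z + y + w));
  congr (_ + _).
rewrite !triD; apply: eq_tri => i j k; rewrite !mxE; ring.
Qed.

Lemma model_mul1 : left_id model_one model_mul.
Proof.
move=> [a S z]; rewrite /model_mul /=; congr Model.
- exact: add0r.
- by apply/matrixP => i j; rewrite !mxE; ring.
rewrite add0r (_ : tri _ = 0) ?addr0 // -tri0.
by apply: eq_tri => i j k; rewrite !mxE; ring.
Qed.

Lemma model_mulr1 : right_id model_one model_mul.
Proof.
move=> [a S z]; rewrite /model_mul /=; congr Model.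
- exact: addr0.
- by apply/matrixP => i j; rewrite !mxE; ring.
rewrite addr0 (_ : tri _ = 0) ?addr0 // -tri0.
by apply: eq_tri => i j k; rewrite !mxE; ring.
Qed.

Lemma model_mulV : left_inverse model_one model_inv model_mul.
Proof.
move=> [a S z]; rewrite /model_mul /=; congr Model.
- exact: addNr.
- by apply/matrixP => i j; rewrite !mxE; ring.
rewrite (addrAC (- z)) addNr add0r addrC; apply/eqP; rewrite subr_eq0;
  apply/eqP.
by apply: eq_tri => i j k; rewrite !mxE; ring.
Qed.

Lemma model_mulrV : right_inverse model_one model_inv model_mul.
Proof.
move=> [a S z]; rewrite /model_mul /=; congr Model.
- exact: addrN.
- by apply/matrixP => i j; rewrite !mxE; ring.
rewrite (addrA z) subrr add0r addrC; apply/eqP; rewrite subr_eq0; apply/eqP.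
by apply: eq_tri => i j k; rewrite !mxE; ring.
Qed.

HB.instance Definition _ :=
  isGroup.Build model model_mulA model_mul1 model_mulr1 model_mulV model_mulrV.

Implicit Types m : model.

Lemma deg1M m m' : deg1 (m * m')%g = deg1 m + deg1 m'.
Proof. by []. Qed.

Lemma deg2M m m' :
  deg2 (m * m')%g = deg2 m + deg2 m' + outer (deg1 m) (deg1 m').
Proof. by []. Qed.

Lemma outer0l a : outer 0 a = 0.
Proof. by apply/matrixP => i j; rewrite !mxE mul0r. Qed.

Lemma outer0r a : outer a 0 = 0.
Proof. by apply/matrixP => i j; rewrite !mxE mulr0. Qed.

Lemma outer_delta i j : outer (delta_mx 0 i) (delta_mx 0 j) = delta_mx i j.
Proof. by apply/matrixP => k l; rewrite !mxE /= -natrM mulnb. Qed.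

Lemma deg1_commg m m' : deg1 [~ m, m']%g = 0.
Proof.
move: (commgC m m'); move: [~ m, m']%g => q /(congr1 (@deg1)).
by rewrite !deg1M addrC -[LHS]addr0 => /addrI.
Qed.

(** Compare degree 2 in [m * m' = m' * m * [~ m, m']]; this avoids expanding [model_inv], and the
    last factor has no linear part. *)
Lemma deg2_commg m m' :
  deg2 [~ m, m']%g = outer (deg1 m) (deg1 m') - outer (deg1 m') (deg1 m).
Proof.
move: (commgC m m') (deg1_commg m m'); move: [~ m, m']%g => q mq q1.
have := congr1 (@deg2) mq; rewrite (deg2M (m' * m)%g) !deg2M q1 outer0r addr0.
rewrite (addrC (deg2 m')) -!addrA => /addrI/addrI ->.
by rewrite addrAC subrr add0r.
Qed.

Lemma lcs2_deg1 m : lcs model 2 m -> deg1 m = 0.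
Proof.
apply: (gen_sub (A := [set m | deg1 (m : model) = 0]%classic)) => /=;
  last first.
  by move=> _ [a [b [_ _ ->]]]; apply: deg1_commg.
by split=> //= u v -> ->; rewrite subr0.
Qed.

Lemma lcs3_deg2 m : lcs model 3 m -> deg1 m = 0 /\ deg2 m = 0.
Proof.
apply: (gen_sub (A := [set m | deg1 (m : model) = 0 /\ deg2 m = 0]%classic)).
  split=> //= u v [hu1 hu2] [hv1 hv2].
  by rewrite hu1 hu2 hv1 hv2 !outer0l !oppr0 !addr0.
move=> _ [a [b [ha _ ->]]]; split; first exact: deg1_commg.
by rewrite deg2_commg (lcs2_deg1 ha) outer0l outer0r subr0.
Qed.

Lemma deg3_central m : deg1 m = 0 -> deg2 m = 0 -> forall m', commute m m'.
Proof.
case: m => [a S z] /= -> -> [b T y]; congr Model => /=.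
- exact: addrC.
- by rewrite outer0l outer0r !addr0 add0r.
rewrite (addrC z); congr (_ + _); apply: eq_tri => i j k; rewrite !mxE; ring.
Qed.

Lemma lcs4_model m : lcs model 4 m -> m = 1%g.
Proof.
apply: (gen_sub (A := [set 1%g : model]%classic)).
  by split=> //= u v -> ->; rewrite mulgV.
move=> _ [a [b [ha _ ->]]] /=; apply/commute1P.
by have [a1 a2] := lcs3_deg2 ha; apply: deg3_central.
Qed.

Definition model_gen i : model := Model (delta_mx 0 i) 0 0.

(* The third power of a generator has R i i i in degree 3; this matters when
   p = 3. *)
Lemma model_gen_exp i : prime p -> odd p -> (forall i, R i i i = 0) ->
  (model_gen i ^+ p)%g = 1%g.
Proof.
move=> p_prime p_odd Ri.
(* This is the binomial expansion of the k-th power of [1 + e_i], whose cubic term vanishes by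
   [Ri]. *)
have X k : (model_gen i ^+ k)%g = Model (delta_mx 0 i *+ k) (delta_mx i i *+
  'C(k, 2)) 0.
  elim: k => [|k IH]; first by rewrite !mulr0n.
  rewrite expgS IH; congr Model => /=.
  - by rewrite mulrS.
  - rewrite add0r binS bin1 mulrnDr; congr (_ + _).
    by apply/matrixP => k' l;
      rewrite -outer_delta !mulmxnE !mxE mulmxnE mxE [LHS]mulrnAr.
  rewrite !add0r /tri big1 // => a _; rewrite big1 // => b _;
    rewrite big1 // => c _.
  have [->|/negPf ai] := eqVneq a i;
    last by rewrite !mxE ai andbF !mul0r addr0 scale0r.
  have [->|/negPf bi] := eqVneq b i; last first.
    by rewrite mulmxnE !mxE bi mul0rn mulr0 mul0r addr0 scale0r.
  have [->|/negPf ci] := eqVneq c i; first by rewrite Ri scaler0.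
  by rewrite mulmxnE !mxE ci andbF mul0rn mulr0 mul0r addr0 scale0r.
have pN0 : (p%:R : 'F_p) = 0 by apply/eqP;
  rewrite -(dvdn_pcharf (pchar_Fp p_prime)).
have pN0mx u v (A : 'M['F_p]_(u, v)) : A *+ p = 0 by rewrite -scaler_nat pN0
  scale0r.
by rewrite X bin2odd // mulrnA !pN0mx mul0rn.
Qed.

(** The degree 3 part of the ring commutator [S e_k - e_k S], with [S] read as a degree 2 tensor. *)
Definition defect k S : Z :=
  tri (fun i j l => S i j * (l == k)%:R - (i == k)%:R * S j l).

Lemma defect_linear k : linear (defect k).
Proof.
move=> c S T; rewrite /defect -triZ triD; apply: eq_tri => i j l.
rewrite !mxE; ring.
Qed.
HB.instance Definition _ k :=
  GRing.isLinear.Build 'F_p 'M['F_p]_n Z _ (defect k) (defect_linear k).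

Lemma tri_delta i j k :
  tri (fun i' j' k' => (i' == i)%:R * (j' == j)%:R * (k' == k)%:R) = R i j k.
Proof.
rewrite -[RHS](sum_ub3 R); do 3![apply: eq_bigr => ? _]; by rewrite !mxE.
Qed.

Lemma defect_delta k i j : defect k (delta_mx i j) = R i j k - R k i j.
Proof.
apply/eqP; rewrite eq_sym subr_eq -!tri_delta /defect triD; apply/eqP.
by apply: eq_tri => i' j' k'; rewrite !mxE -!mulnb !natrM; ring.
Qed.

(** Without a linear part in [m], the two products agree in degrees 1 and 2 and differ in degree 3
    by the defect. *)
Lemma commute_gen m k : deg1 m = 0 ->
  commute m (model_gen k) <-> defect k (deg2 m) = 0.
Proof.
case: m => [a S z] /= ->.
pose t1 i j l := S i j * (l == k)%:R; pose t2 i j l := (i == k)%:R * S j l.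
have dE : tri t1 = tri t2 + defect k S.
  by rewrite triD; apply: eq_tri => i j l; rewrite /t1 /t2; ring.
have e1 : ((Model 0 S z : model) * model_gen k)%g
    = Model (delta_mx 0 k) S (z + tri t1).
  congr Model; rewrite /= ?outer0l ?addr0 ?add0r //; congr (_ + _).
  by apply: eq_tri => i j l; rewrite !mxE /= mul0r add0r.
have e2 : (model_gen k * (Model 0 S z : model))%g
    = Model (delta_mx 0 k) S (z + tri t2).
  congr Model; rewrite /= ?outer0r ?addr0 ?add0r //; congr (_ + _).
  by apply: eq_tri => i j l; rewrite !mxE /= mulr0 addr0.
rewrite /commute e1 e2 dE; split=> [/(congr1 (@deg3)) /= /addrI /eqP|->].
  by rewrite -subr_eq0 addrAC subrr add0r => /eqP.
by rewrite addr0.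
Qed.

(** For [k] different from [i], the (i, k) entries of [outer (deg1 m) e_k] and [outer e_k (deg1 m)]
    are the i-th coordinate and 0; [1 < n] supplies such a [k]. *)
Lemma commute_gens_deg1 m :
  (1 < n)%N -> (forall k, commute m (model_gen k)) -> deg1 m = 0.
Proof.
move=> n_gt1 mC; apply/rowP => i; rewrite mxE.
have [k ik] : exists k, i != k.
  have [i0|i0] := eqVneq (i : nat) 0%N; first by exists (Ordinal n_gt1);
    rewrite -val_eqE /= i0.
  by exists (Ordinal (ltnW n_gt1)); rewrite -val_eqE.
have := congr1 (@deg2) (mC k); rewrite !deg2M (addrC (deg2 m)) => /addrI.
by move/matrixP => /(_ i k); rewrite !mxE !eqxx (negPf ik) /= mulr1 mul0r.
Qed.

End Model.

(** * Alternating matrices *)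

Section Skew.

Variables (p n : nat).
Local Open Scope ring_scope.
Implicit Types s t : 'M['F_p]_n.

(** The image of [V_elt s] in the tensor square under the embedding that sends [u_j /\ u_i] to
    [e_j e_i - e_i e_j]. *)
Definition alt_mx s : 'M['F_p]_n :=
  sum_lt (fun j i => delta_mx j i - delta_mx i j) s.

Lemma alt_mx_entry s (i j : 'I_n) : (i < j)%N -> alt_mx s j i = s i j.
Proof.
move=> ij; have /negPf ji : j != i by rewrite -val_eqE /= gtn_eqF.
rewrite /alt_mx /sum_lt summxE (bigD1 i) //= [X in _ + X]big1 ?addr0;
  last first.
  move=> i' ii; rewrite summxE big1 // => j' ij';
    rewrite !mxE [i == i']eq_sym (negPf ii).
  (* A contribution from the transposed matrix unit would require [j < i]. *)
  rewrite andbF sub0r; case: andP => [[/eqP ji' /eqP ij'E]|];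
    last by rewrite oppr0 mulr0.
  by rewrite -ji' -ij'E ltnNge (ltnW ij) in ij'.
rewrite summxE (bigD1 j) //= big1 ?addr0 => [|j' /andP[_ jj]]; rewrite !mxE ji.
  by rewrite !eqxx subr0 mulr1.
by rewrite [j == j']eq_sym (negPf jj) subr0 mulr0.
Qed.

End Skew.

(** * Degrees of images of F in the model *)

Section Representation.

Variables (p n : nat) (p_prime : prime p) (p_odd : odd p).
Variables (Z : lmodType 'F_p) (R : 'I_n -> 'I_n -> 'I_n -> Z).
Variable rho : {multiplicative F3 p n -> model_of R}.
Hypothesis rho_gen : forall i, rho (F3_gen p i) = model_gen R i.
Local Notation F := (F3 p n).
Local Notation x := (@F3_gen p n).

Lemma rho_lcs3 z : lcs F 3 z -> deg1 (rho z) = 0%R /\ deg2 (rho z) = 0%R.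
Proof. by move=> hz; apply: lcs3_deg2; apply: lcs_morph. Qed.

(* Modulo F_2, both z and prod x_i^(deg1 (rho z) i) are multiplicative in z and
   they agree on the generators. *)
Lemma deg1_rho_lcs2 z : deg1 (rho z) = 0%R -> lcs F 2 z.
Proof.
pose q := coset (lcsN F 2); pose c i := q (x i).
have cp i : c i ^+ p = 1.
  by rewrite /c /q -multX F3_gen_exp // mult1.
have cC i j : commute (c i) (c j).
  apply/commute1P; rewrite /c /q -(multR _ (x i) (x j)); apply/coset_eq1.
  exact: (@lcsS F 0 _ _ (lcs1 _)).
pose e z := [ffun i => deg1 (rho z) 0%R i].
suff h : q z = prodX c (e z).
  move=> z0; apply/(coset_eq1 (lcsN F 2));
    rewrite -/q h -[RHS](prodX0 p_prime cp cC).
  by congr prodX; apply/ffunP => i; rewrite !ffunE z0 mxE.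
elim/F3_ind: z => [|k z IH].
  rewrite /q mult1 -[LHS](prodX0 p_prime cp cC).
  by congr prodX; apply/ffunP => i; rewrite !ffunE mult1 mxE.
have -> : q (x k * z) = c k * q z by exact: gmulfM.
rewrite IH -[c k]/(c k ^+ (1%R : 'F_p)) -(prodX_delta c) -(prodXD p_prime cp
  cC); congr prodX; apply/ffunP => i.
by rewrite !ffunE gmulfM rho_gen !mxE eqxx /=; case: eqP.
Qed.

(** Degree 2 parts add when linear parts vanish, so each [[x_j, x_i]] contributes
    [e_j e_i - e_i e_j] independently. *)
Lemma rho_C_elt s :
  deg1 (rho (C_elt s)) = 0%R /\ deg2 (rho (C_elt s)) = alt_mx s.
Proof.
rewrite C_eltE mult_prod_lt.
pose Q (m : model_of R) S := deg1 m = 0%R /\ deg2 m = S.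
have Q1 : Q 1 0%R by [].
have QM m m' S S' : Q m S -> Q m' S' -> Q (m * m') (S + S')%R.
  by move=> [h1 h2] [h1' h2'];
    rewrite /Q deg1M deg2M h1 h1' h2 h2' outer0l !addr0.
rewrite -/(Q _ _) /prod_lt /alt_mx /sum_lt.
elim/big_rec2: _ => [//|i S m _ Qm]; apply: (QM) Qm.
elim/big_rec2: _ => [//|j {}S {}m _ Qm]; apply: (QM) Qm.
rewrite multR !rho_gen.
have {Q1} Qc : Q [~ model_gen R j, model_gen R i] (delta_mx j i - delta_mx i
  j)%R.
  by split; rewrite ?deg1_commg // deg2_commg !outer_delta.
have QX k : Q ([~ model_gen R j, model_gen R i] ^+ k) ((delta_mx j i - delta_mx
  i j) *+ k)%R.
  elim: k => [//|k IH]; rewrite expgS mulrS; exact: QM.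
by have := QX (s i j); rewrite -scaler_nat natr_Zp.
Qed.

End Representation.

Lemma isomorphic_of_kernel (F G H : groupType) (f : {multiplicative F -> G})
    (h : {multiplicative F -> H}) :
    (forall y, exists z, f z = y) -> (forall y, exists z, h z = y) ->
    (forall z, f z = 1 <-> h z = 1) -> isomorphic G H.
Proof.
move=> /choice[s sK] /choice[t tK] fh.
have fhE a b : f a = f b <-> h a = h b.
  have e (K : groupType) (k : {multiplicative F -> K}) : k a = k b <-> k (a /
    b) = 1.
    by rewrite gmulfM multV; split=> [->|/divg1_eq //]; rewrite mulgV.
  by rewrite !e.
pose k y := h (s y).
have kM : {morph k : a b / a * b}.
  by move=> a b; rewrite /k -gmulfM; apply/fhE; rewrite gmulfM !sK.
pose k' : {multiplicative G -> H} := HB.pack k (isMultiplicative.Build _ _ k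
  kM).
exists k'; exists (fun y => f (t y)) => y /=.
  by rewrite -[RHS]sK; apply/fhE; rewrite tK.
by rewrite /k' /= /k -[RHS]tK; apply/fhE; rewrite sK.
Qed.

(** * Bases, closures and brackets *)

Section LowerBracket.

Variables (n : nat) (E : zmodType) (B : 'I_n -> 'I_n -> 'I_n -> E).
Hypothesis Balt : forall i k, B i i k = 0%R.
Hypothesis Banti : forall i j k, B i j k = (- B j i k)%R.
Hypothesis BJacobi : forall i j k, (B i j k + B j k i + B k i j = 0)%R.
Local Open Scope ring_scope.

(* As a linear map on the tensor cube of the space, this is a left inverse of
   (a /\ b) (x) c |-> [[a, b], c]; unlike the Dynkin operator it involves no
   division by 3, and it kills the cubes of the basis vectors. *)
Definition lower (i j k : 'I_n) : E :=
  if ((i < j) && (i < k))%N || (j == k) then B i j k else 0.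

Lemma lower_diag i : lower i i i = 0.
Proof. by rewrite /lower eqxx orbT. Qed.

(** The left side is [lower] on the four words of [[[e_i, e_j], e_k]]. For distinct indices only
    words starting with the least index survive: one word, and antisymmetry at most, if that is [i]
    or [j]; two words and Jacobi if it is [k]. The clause [j == k] of [lower] serves repeated
    indices. *)
Lemma lowerE i j k :
  lower i j k - lower k i j - (lower j i k - lower k j i) = B i j k.
Proof.
rewrite /lower; have [->|ij] := eqVneq i j; first by rewrite Balt subrr.
have [<-|jk] := eqVneq j k.
  by rewrite (negPf ij) ltnn !andbF orbT /= !subr0.
have [<-|ik] := eqVneq i k.
  by rewrite ltnn !andbF orbT /= !subr0 sub0r -Banti.
have -> : B k j i = B i j k + B k i j.
  rewrite Banti; apply/eqP; rewrite eq_sym -addr_eq0 addrAC.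
  by rewrite BJacobi.
rewrite (Banti j) !orbF; move: (B i j k) (B k i j) => u v.
have := jk; have := ik; have := ij; rewrite -!val_eqE /= {ij ik jk}.
case: (ltngtP i j) => // ij _; case: (ltngtP i k) => // ik _ jk.
- by rewrite !andbF /= !subr0.
- by rewrite (ltn_trans ik ij) /= !sub0r opprK addrC addrK.
- by rewrite (ltn_trans ij ik) andbF /= !subr0 sub0r opprK.
- case: (ltngtP j k) jk => //= _ _; first by rewrite !subr0 sub0r opprK.
  by rewrite !sub0r opprK addrC addrK.
Qed.

End LowerBracket.

(** * Coordinates in V and the closure operators *)

Section Spaces.

Variables (p n : nat) (p_prime : prime p) (p_odd : odd p).
Local Notation V := (V p n).
Local Notation W := (W p n).
Implicit Types (s t : 'M['F_p]_n) (v : V).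
Local Open Scope ring_scope.

(** The lift to matrices of [u_i /\ u_j |-> e_i e_j - e_j e_i] sends [V_elt s] to [alt_mx s], whose
    entries return the coefficients. *)
Lemma V_elt_inj s t : V_elt s = V_elt t ->
  forall i j : 'I_n, (i < j)%N -> s i j = t i j.
Proof.
have [i j|f fE] := @wedge_lift p n p_prime p_odd 'M['F_p]_n
  (fun i j => delta_mx i j - delta_mx j i); first by rewrite opprB.
have fV r : f (V_elt r) = alt_mx r.
  rewrite V_eltE linear_sum_lt; apply: eq_bigr => i _; apply: eq_bigr => j _.
  by rewrite /= fE sum_ub2.
by move=> e i j ij; rewrite -(alt_mx_entry s ij) -(alt_mx_entry t ij) -!fV e.
Qed.

(** [C_elt] and [V_elt] are both additive in the coefficients, so for a subgroup the spanning
    vectors are closed under addition and [mem_sum_lines] applies. *)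
Lemma mem_subspace_of (X : set (F3 p n)) v : subgroup X ->
  v \in subspace_of X <-> exists2 s, X (C_elt s) & v = V_elt s.
Proof.
move=> hX; rewrite /subspace_of.
have h0 : exists2 s : 'M['F_p]_n, `[< X (C_elt s) >] & V_elt s = 0.
  exists 0; last by rewrite V_eltE linear0.
  by apply/asboolP; rewrite C_elt0 //; apply: hX.1.
have hD s t : `[< X (C_elt s) >] -> `[< X (C_elt t) >] ->
    exists2 r, `[< X (C_elt r) >] & V_elt r = V_elt s + V_elt t.
  move=> /asboolP hs /asboolP ht; exists (s + t).
    by apply/asboolP; rewrite C_eltD //; apply: subgroupM.
  by rewrite !V_eltE linearD.
have h := @mem_sum_lines _ _ _ _ _ v h0 hD.
split=> [/h[s /asboolP hs ->]|[s hs vs]]; first by exists s.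
by apply/h; exists s => //; apply/asboolP.
Qed.

Lemma mem_downstar (Y : {vspace W}) v :
  reflect (forall k, phi (ub p k) v \in Y) (v \in downstar Y).
Proof.
have h : reflect (forall u, phi u v \in Y) (v \in downstar Y).
  apply: (iffP idP) => [hv u|hv].
    have hu : (downstar Y <= phi u @^-1: Y)%VS.
      exact: (@bigcapv_inf _ _ _ (u : 'rV['F_p]_n)).
    by rewrite memv_preim (subvP hu).
  rewrite /downstar memvE; apply/subv_bigcapP => u _.
  by rewrite -memvE -memv_preim.
apply: (iffP h) => [hv k|hv u]; first exact: hv.
by rewrite phi_expand; apply: memv_suml => k _; apply: memvZ.
Qed.

Lemma upstar_sub (A : {vspace V}) (Y : {vspace W}) :
  (forall v k, v \in A -> phi (ub p k) v \in Y) -> (upstar A <= Y)%VS.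
Proof.
move=> h; apply/subv_sumP => u _; apply/subvP => _ /memv_imgP[v vA ->].
by rewrite phi_expand; apply: memv_suml => k _; apply/memvZ/h.
Qed.

Lemma phi_upstar (A : {vspace V}) v (u : U p n) : v \in A -> phi u v \in upstar
  A.
Proof.
move=> vA; apply: (subvP (sumv_sup (u : 'rV_n) _ (subvv _))) => //.
exact: memv_img.
Qed.

(** A subspace always lies in its double star, so only the reverse inclusion carries content. *)
Lemma phi_closedP (A : {vspace V}) :
  phi_closed A <-> (forall v, v \in downstar (upstar A) -> v \in A).
Proof.
split=> [e v|h]; first by rewrite -e.
apply/eqP; rewrite eqEsubv; apply/andP; split; apply/subvP => v; last exact: h.
by move=> vA; apply/mem_downstar => k; apply: phi_upstar.
Qed.

End Spaces.

(** * Detecting central elements *)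

Section MainRepresentation.

Variables (p n : nat) (p_prime : prime p) (p_odd : odd p).
Local Notation F := (F3 p n).
Local Notation x := (@F3_gen p n).
Variable Y : {vspace W p n}.

(** Degree 3 coefficients of the model: the left inverse [lower] into W, followed by reduction
    modulo [Y]. *)
Definition lower_mod (i j k : 'I_n) : quotv Y :=
  piv Y (lower (fun i j k => bracket (ub p i) (ub p j) (ub p k)) i j k).

(** By [lowerE], the ring commutator of the Lie element of [V_elt s] with [e_k] is sent back to its
    bracket in W, here taken modulo [Y]. *)
Lemma defect_alt_mx k s :
  defect lower_mod k (alt_mx s) = piv Y (phi (ub p k) (V_elt s)).
Proof.
rewrite /alt_mx linear_sum_lt V_eltE !linear_sum_lt.
apply: eq_bigr => i _; apply: eq_bigr => j _; congr (_ *: _)%R => /=.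
rewrite linearB /= !defect_delta -!linearB lowerE //.
- by move=> i' k'; apply: bracket_alt.
- by move=> i' j' k'; apply: bracket_anti.
- by move=> i' j' k'; apply: bracket_Jacobi.
Qed.

Lemma rep_exists : exists rho : {multiplicative F -> model_of lower_mod},
  forall i, rho (x i) = model_gen lower_mod i.
Proof.
apply: F3_lift => // [z|i]; first exact: lcs4_model.
apply: model_gen_exp => // j.
(* The coefficient at the cube of a basis vector is a bracket with equal first two entries, hence
   0. *)
by rewrite /lower_mod lower_diag ?linear0 // => i' k'; apply: bracket_alt.
Qed.

Variable rho : {multiplicative F -> model_of lower_mod}.
Hypothesis rho_gen : forall i, rho (x i) = model_gen lower_mod i.

(** The factor [f] is invisible in degrees 1 and 2, so [commute_gen] and [defect_alt_mx] reduce
    commutation to the bracket modulo [Y]. *)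
Lemma commute_rho s f k : lcs F 3 f ->
  commute (rho (C_elt s * f)) (rho (x k)) <-> phi (ub p k) (V_elt s) \in Y.
Proof.
move=> hf; have [s1 s2] := rho_C_elt rho_gen s.
have [f1 f2] := rho_lcs3 rho hf.
have z1 : deg1 (rho (C_elt s * f)) = 0%R by rewrite gmulfM deg1M s1 f1 addr0.
have z2 : deg2 (rho (C_elt s * f)) = alt_mx s.
  by rewrite gmulfM deg2M s1 s2 f2 outer0l !addr0.
rewrite rho_gen commute_gen // z2 defect_alt_mx -piv_eq0.
by split=> [->|/eqP].
Qed.

(** This shows that C meets F_3 trivially: F_3 has no degree 2 part, while [C_elt s] has
    [alt_mx s]. *)
Lemma C_elt_lcs3 s : lcs F 3 (C_elt s) ->
  forall i j : 'I_n, (i < j)%N -> s i j = 0%R.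
Proof.
move=> hs i j ij; have [_ s2] := rho_C_elt rho_gen s.
by rewrite -(alt_mx_entry s ij) -s2 (rho_lcs3 rho hs).2 mxE.
Qed.

Lemma center_rho_lcs2 z : (1 < n)%N ->
  (forall k, commute (rho z) (rho (x k))) -> lcs F 2 z.
Proof.
move=> n_gt1 h; apply: (deg1_rho_lcs2 p_prime rho_gen).
by apply: commute_gens_deg1 => // k; rewrite -rho_gen.
Qed.

End MainRepresentation.

(** * Surjectivity of psi and the rank of G *)

Section Setting.

Variables (p n : nat) (p_prime : prime p) (p_odd : odd p).
Local Notation F := (F3 p n).
Local Notation x := (@F3_gen p n).
Variables (G : groupType) (G_class : class_le G 2) (psi : {multiplicative F ->
  G}).

Lemma class2_comm3 (a b c : G) : [~ a, b, c] = 1.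
Proof.
have : lcs G 3 [~ a, b, c] by exact: (@lcsS G 1 _ _ (@lcsS G 0 _ _ (lcs1 _))).
by rewrite G_class.
Qed.

Lemma image_subgroup : subgroup [set y | exists z, psi z = y]%classic.
Proof.
split; first by exists 1; rewrite mult1.
by move=> _ _ [a <-] [b <-]; exists (a / b); rewrite gmulfM multV.
Qed.

(** The [g i] give each element as [psi z] times some [c] in G_2. As G_2 is central, such factors
    drop out of commutators, so G_2 itself lies in the image. *)
Lemma psi_surj (g : 'I_n -> G) : (forall i, psi (x i) = g i) -> ab_basis p g ->
  forall y, exists z, psi z = y.
Proof.
move=> psi_gen g_basis.
have dec y : exists z c, lcs G 2 c /\ y = psi z * c.
  have [a [ya _]] := g_basis (coset (lcsN G 2) y).
  pose z : F := \prod_(i < n) x i ^+ (a i : nat).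
  exists z, ((psi z)^-1 * y); rewrite mulVKg; split=> //.
  apply/(cosetE (lcsN G 2)); rewrite ya /z !mult_prod.
  by apply: eq_bigr => i _; rewrite !multX psi_gen.
have cen c : lcs G 2 c -> forall w, [~ c, w] = 1.
  move=> hc w; have : lcs G 3 [~ c, w] by exact: (@lcsS G 1).
  by rewrite G_class.
have lcs2_im c : lcs G 2 c -> exists z, psi z = c.
  move=> hc; apply: (gen_sub image_subgroup) hc => _ [a [b [_ _ ->]]].
  have [z [d [hd ->]]] := dec a; have [z' [d' [hd' ->]]] := dec b.
  exists [~ z, z']; rewrite multR commMgJ_group (cen _ hd) mulg1.
  rewrite commgMJ_group -(invgR d') (cen _ hd') invg1 mul1g.
  by rewrite !conjg_commute //; apply/commute1P; apply: class2_comm3.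
move=> y; have [z [c [/lcs2_im[z' <-] ->]]] := dec y.
by exists (z * z'); rewrite gmulfM.
Qed.

(** With at most one generator, F consists of powers of a single element, so its image G is
    cyclic. *)
Lemma noncyclic_rank : (forall y, exists z, psi z = y) -> ~ is_cyclic G ->
  (1 < n)%N.
Proof.
move=> psi_s G_nc; rewrite ltnNge; apply/negP => n_le1; apply: G_nc.
have [i0 i0E] : exists y : F, forall i, x i = y.
  (* For [n = 0] there is no generator to pick and 1 serves instead. *)
  case: (pickP 'I_n) => [i _|h]; last by exists 1 => i; have := h i.
  exists (x i) => j; congr x; apply: ord_inj.
  have li := leq_trans (ltn_ord i) n_le1;
    have lj := leq_trans (ltn_ord j) n_le1.
  by move: li lj; rewrite !ltnS !leqn0 => /eqP-> /eqP->.
exists (psi i0) => y; have [z <-] := psi_s y.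
suff [k ->] : exists k, z = i0 ^+ k by exists k; left; rewrite multX.
elim/F3_ind: z => [|k z [m ->]]; first by exists 0%N.
by exists m.+1; rewrite i0E expgS.
Qed.

End Setting.

(** * Capability *)

Section Capability.

Variables (p n : nat) (p_prime : prime p) (p_odd : odd p).
Local Notation F := (F3 p n).
Local Notation x := (@F3_gen p n).
Variables (G : groupType) (psi : {multiplicative F -> G}).
Hypothesis psi_s : forall y, exists z, psi z = y.
Variables (X : set F) (X_subgroup : subgroup X).
Hypothesis X_sub_C : (X `<=` @F3_C p n)%classic.
Hypothesis N_sum : direct_sum X (lcs F 3) (kernel psi).

Lemma psi1P z : psi z = 1 <-> exists s f, [/\ X (C_elt s), lcs F 3 f & z =
  C_elt s * f].
Proof.
have [_ _ _ kE] := N_sum; have -> : (psi z = 1) = kernel psi z by [].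
rewrite kE; split=> [[a [f [ha hf ->]]]|[s [f [hs hf ->]]]];
  last by exists (C_elt s), f.
by have [s aE] := F3_C_elt p_prime p_odd (X_sub_C ha); exists s, f; rewrite -aE.
Qed.

Lemma closed_capable : (1 < n)%N -> phi_closed (subspace_of X) -> capable G.
Proof.
move=> n_gt1 /phi_closedP X_closed; pose Y := upstar (subspace_of X).
have [rho rho_gen] := rep_exists p_prime p_odd Y.
(* Since [rho] need not be onto the model, centrality is tested only inside its image, on the
   generators of F. *)
have key z : psi z = 1 <-> forall k, commute (rho z) (rho (x k)).
  split=> [/psi1P[s [f [hs hf ->]]] k|h].
    apply/(commute_rho rho_gen) => //; apply: phi_upstar.
    by apply/mem_subspace_of => //; exists s.
  have [s [f [hf zE]]] := lcs2_C_elt p_prime p_odd (center_rho_lcs2 p_prime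
    rho_gen n_gt1 h).
  have : V_elt s \in subspace_of X.
    apply: X_closed; apply/mem_downstar => k.
    by apply/(commute_rho rho_gen s k hf); rewrite -zE.
  case/mem_subspace_of => // t ht st.
  apply/psi1P; exists t, f; split=> //; rewrite zE; congr (_ * _).
  (* The matrices [s] and [t] may differ on or below the diagonal, where neither [C_elt] nor [V_elt]
     reads them. *)
  exact: eq_prod_lt (V_elt_inj p_prime p_odd st).
have normal_ker : is_normal (kernel rho).
  split=> [|a b]; rewrite /kernel /=.
    split=> [|a b]; rewrite /kernel /= ?mult1 // gmulfM multV => -> ->.
    by rewrite mulgV.
  by rewrite conjgE !gmulfM multV => ->; rewrite mul1g mulVg.
(* The witness is F modulo the kernel of [rho]; its central quotient and G are both quotients of F,
   with the same kernel by [key]. *)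
pose K := NormalSub normal_ker; exists (quotg K).
pose q1 : {multiplicative F -> quotg K} := coset K.
pose q2 : {multiplicative quotg K -> quotg (centerN (quotg K))} := coset
  (centerN (quotg K)).
have qM : {morph (fun z => q2 (q1 z)) : a b / a * b} by move=> a b;
  rewrite !gmulfM.
pose q : {multiplicative F -> quotg (centerN (quotg K))} :=
  HB.pack (fun z => q2 (q1 z)) (isMultiplicative.Build _ _ _ qM).
apply: (isomorphic_of_kernel (f := psi) (h := q)) => // [y|z].
  by have [y' ->] := coset_surj y; have [z ->] := coset_surj y'; exists z.
have q1P a b : commute (q1 a) (q1 b) <-> commute (rho a) (rho b).
  rewrite !commute1P -!multR; exact: (coset_eq1 K).
rewrite key; split=> [h|/(coset_eq1 (centerN (quotg K))) h k]; last first.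
  by apply/q1P; apply: h.
apply/(coset_eq1 (centerN (quotg K))) => w; have [b ->] := coset_surj w.
apply/q1P; move: b; apply: F3_subgroup_full => [|k]; last exact: h.
split=> [|a b ha hb]; first by rewrite mult1; apply: commute1.
by rewrite gmulfM multV; apply: commuteM => //; apply: commuteV.
Qed.

(** * From a central quotient to closure *)

Section Converse.

Variables (g : 'I_n -> G) (psi_gen : forall i, psi (x i) = g i).
Hypothesis G_comm3 : forall a b c : G, [~ a, b, c] = 1.
Hypothesis G_exp : forall y : G, y ^+ p = 1.
Variables (H : groupType) (f : {multiplicative G -> quotg (centerN H)}).
Hypothesis f_bij : bijective f.

Let q := coset (centerN H).

Let f1P y : f y = 1 <-> y = 1.
Proof.
split=> [fy|->]; last exact: mult1.
by apply: (bij_inj f_bij); rewrite fy mult1.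
Qed.

Let q1P (h : H) : q h = 1 <-> forall w, commute h w.
Proof. exact: coset_eq1. Qed.

Let lift_f (h : H) : exists y, q h = f y.
Proof. by have [k _ kK] := f_bij; exists (k (q h)); rewrite kK. Qed.

(** Triple commutators of [H] die in H / Z(H), which has class at most two like G, so they are
    central. *)
Let H_class3 (a b c d : H) : commute [~ a, b, c] d.
Proof.
apply/q1P: d; have [a' aE] := lift_f a; have [b' bE] := lift_f b.
have [c' cE] := lift_f c.
have -> : q [~ a, b, c] = [~ q a, q b, q c] by rewrite /q !multR.
by rewrite aE bE cE -!multR; apply/f1P.
Qed.

Let H_exp (a b : H) : commute (a ^+ p) b.
Proof.
apply/q1P: b; have [a' aE] := lift_f a.
have -> : q (a ^+ p) = q a ^+ p by rewrite /q multX.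
by rewrite aE -multX G_exp mult1.
Qed.

Let h i : H := repr (f (g i)).

Let hE i : q (h i) = f (g i).
Proof. by rewrite /q /coset reprK. Qed.

Let hc (s : 'M['F_p]_n) : H := prod_lt (fun i j => [~ h i, h j]) s.

Let hcE s : q (hc s) = f (psi (C_elt s)).
Proof.
rewrite /hc C_eltE [LHS](mult_prod_lt q) !mult_prod_lt.
apply: eq_bigr => i _; apply: eq_bigr => j _; congr (_ ^+ _).
by rewrite /= !multR !psi_gen -!hE.
Qed.

Let hc_central s : (forall w, commute (hc s) w) <-> psi (C_elt s) = 1.
Proof. by rewrite -f1P -hcE q1P. Qed.

(** The [h k] generate H modulo its centre, because the [x k] generate F and [psi] is onto. *)
Let hc_commute_gen s : (forall k, commute (hc s) (h k)) -> forall w, commute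
  (hc s) w.
Proof.
move=> hk w; have [y yE] := lift_f w; have [z zE] := psi_s y.
move: yE; rewrite -{}zE {y}; elim/F3_ind: z w => [|k z IH] w.
  by rewrite !mult1 => /q1P wZ; apply/commute_sym.
rewrite !gmulfM psi_gen => wE; rewrite -(mulVKg (h k) w); apply: commuteM => //.
apply: IH; have -> : q ((h k)^-1 * w) = (q (h k))^-1 * q w by rewrite /q gmulfM
  multV.
by rewrite hE wE mulKg.
Qed.

Let t3 (e : 'I_n * 'I_n * 'I_n) : H := [~ h e.1.1, h e.1.2, h e.2].

(** The exponent moves into the last entry, where the p-th power is central because G has exponent
    p. *)
Let t3p e : t3 e ^+ p = 1.
Proof. by rewrite /t3 -(comm3Xr H_class3); apply/commute1P/commute_sym. Qed.

Let t3C e e' : commute (t3 e) (t3 e').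
Proof. exact: H_class3. Qed.

Let hc_commg s k : [~ hc s, h k] = prod_lt (fun i j => t3 (i, j, k)) s.
Proof. exact: commg_prod_lt. Qed.

(** Triple commutators of the [h i] satisfy antisymmetry and Jacobi. Written additively through
    [prodX_linear], they receive a linear map from W by [bracket_lift], and [[~ hc s, h k]]
    corresponds to the image of [phi (ub p k) (V_elt s)]. *)
Let bracket_detect : exists (E : vectType 'F_p) (D : 'Hom(W p n, E)),
  forall s k, commute (hc s) (h k) <-> D (phi (ub p k) (V_elt s)) = 0%R.
Proof.
have [E [L LP]] := prodX_linear p_prime t3p t3C.
pose d e : {ffun 'I_n * 'I_n * 'I_n -> ('F_p)^o} := [ffun e' => (e' == e)%:R%R].
have dE e : prodX t3 (d e) = t3 e.
  rewrite -[RHS]/(t3 e ^+ (1%R : 'F_p)) -prodX_delta; congr prodX.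
  by apply/ffunP => e'; rewrite !ffunE; case: eqP.
have pXD (u v : {ffun 'I_n * 'I_n * 'I_n -> 'F_p}) : prodX t3 (u + v)%R = prodX
  t3 u * prodX t3 v.
  exact: (prodXD p_prime t3p t3C).
(* The triple commutator of [h i], [h j], [h k] in additive form. *)
pose T i j k := L (d (i, j, k)).
have [i j k|i j k|D DE] := @bracket_lift p n p_prime p_odd E T.
- apply/eqP; rewrite -addr_eq0 -linearD; apply/eqP/LP; rewrite pXD !dE.
  by rewrite /t3 /= (comm3_inv H_class3 (h j)) mulVg.
- rewrite -!linearD; apply/LP; rewrite !pXD !dE.
  exact: (comm3_Jacobi H_class3).
exists E, D => s k; rewrite commute1P hc_commg.
rewrite -(prodX_sum_lt p_prime (fun i j => (i, j, k)) s t3p t3C) LP.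
rewrite linear_sum_lt V_eltE !linear_sum_lt.
suff -> : sum_lt (fun j i => L (d (j, i, k))) s
  = sum_lt (fun j i => D (phi (ub p k) (wedge (ub p j) (ub p i)))) s by [].
by apply: eq_bigr => i _; apply: eq_bigr => j _; rewrite [in RHS]DE.
Qed.

Lemma center_quotient_closed : phi_closed (subspace_of X).
Proof.
have [E [D DE]] := bracket_detect; apply/phi_closedP => v.
have Dup : (upstar (subspace_of X) <= lker D)%VS.
  apply: upstar_sub => w k.
  case/(mem_subspace_of p_prime p_odd _ X_subgroup) => s hs ->.
  rewrite memv_ker; apply/eqP/DE; apply: ((hc_central s).2 _ (h k));
    apply/psi1P.
  by exists s, 1; rewrite mulg1; split=> //; apply: (lcs_subgroup F 3).1.
have [s ->] := V_elt_surj v => /mem_downstar sY.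
have : psi (C_elt s) = 1.
  apply/hc_central/hc_commute_gen => k; apply/DE/eqP.
  by rewrite -memv_ker; apply: (subvP Dup).
case/psi1P => t [u [ht hu e]].
(* So far [C_elt s] is known only up to the factor [u] in F_3. Since C meets F_3 trivially, as the
   model with [Y = 0] shows, [C_elt s] itself lies in X. *)
have [rho rho_gen] := rep_exists p_prime p_odd (0%VS : {vspace W p n}).
have st : lcs F 3 (C_elt (s - t)%R).
  rewrite addrC C_eltD // C_eltN // e mulKg.
  exact: hu.
have ste : C_elt t = C_elt s.
  apply: eq_prod_lt => i j ij; apply/esym/eqP; rewrite -subr_eq0.
  by have := C_elt_lcs3 rho_gen st ij; rewrite !mxE => ->.
by apply/mem_subspace_of => //; exists s; rewrite // -ste.
Qed.

End Converse.
End Capability.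

Theorem theorem3p9 (p n : nat) (p_prime : prime p) (p_odd : odd p)
    (G : groupType) (G_noncyclic : ~ is_cyclic G) (G_class : class_le G 2)
    (G_exp : is_exponent G p)
    (g : 'I_n -> G) (g_basis : ab_basis p g)
    (psi : {multiplicative F3 p n -> G})
    (psi_gen : forall i : 'I_n, psi (F3_gen p i) = g i)
    (X : set (F3 p n)) (X_subgroup : subgroup X)
    (X_sub_C : (X `<=` @F3_C p n)%classic)
    (N_sum : direct_sum X (lcs (F3 p n) 3) (kernel psi)) :
  capable G <-> phi_closed (subspace_of X).
Proof.
have psi_s := psi_surj G_class psi_gen g_basis.
split=> [[H [f f_bij]]|].
  have [_ Gp _] := G_exp.
  exact: (center_quotient_closed p_prime p_odd psi_s X_subgroup X_sub_C N_sum
    psi_gen (class2_comm3 G_class) Gp f_bij).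
apply: (closed_capable p_prime p_odd psi_s X_subgroup X_sub_C N_sum).
exact: noncyclic_rank psi_s G_noncyclic.
Qed.
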